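(* Let $\mathbb F$ be a field with $\operatorname{char}\mathbb F=p\neq 0$, and let $R(A,\alpha,v,\rho)$ be an ambiskew polynomial ring over an $\mathbb F$-algebra $A$ (with associated automorphism $\gamma$). Then $R(A,\alpha,v,\rho)$ is simple if and only if the following three conditions hold: (i) $A$ is $\alpha$-simple; (ii) there do not exist a non-negative integer $n$ and elements $b_i$ ($0\leq i\leq n-1$) and $u$ of $A$ such that (a) for $0\leq i\leq n-1$, $\gamma(b_i)=b_i$, $b_i$ is $\gamma^{p^n-p^i}$-normal and $\alpha(b_i)=\rho^{p^i-p^n}b_i$; and (b) $\gamma(u)=u$, $u$ is $\gamma^{p^n}$-normal and $\rho^{p^n}\alpha(u)-u=v^{p^n}+\sum_{i=0}^{n-1}b_iv^{p^i}$; (iii) for all $m\geq 1$, $v^{(m)}:=\sum_{l=0}^{m-1}\rho^{l}\alpha^{l}(v)$ is a unit of $A$.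
   Context: Rings are associative with $1$. For an automorphism $\theta$ of a ring $A$, an element $c\in A$ is $\theta$-normal if $ca=\theta(a)c$ for all $a\in A$ and $\theta(c)=c$. An ideal $I$ of $A$ is an $\alpha$-ideal if $\alpha(I)\subseteq I$; $A$ is $\alpha$-simple if $0$ and $A$ are its only $\alpha$-ideals. Ambiskew polynomial ring: Let $\mathbb F$ be a field, $A$ an $\mathbb F$-algebra, $\rho\in\mathbb F\setminus\{0\}$, $\gamma$ an $\mathbb F$-automorphism of $A$, $v$ a $\gamma$-normal element of $A$, $\alpha$ an $\mathbb F$-automorphism of $A$ with $\alpha\gamma=\gamma\alpha$, and $\beta:=\alpha^{-1}\gamma$. Extend $\beta$ to an automorphism of $A[y;\alpha]$ with $\beta(y)=\rho y$; there is a $\beta$-derivation $\delta$ of $A[y;\alpha]$ with $\delta(A)=0$, $\delta(y)=v$. The ambiskew polynomial ring is $R(A,\alpha,v,\rho)=A[y;\alpha][x;\beta,\delta]$; thus it is generated over $A$ by $x,y$ with $ya=\alpha(a)y$, $xa=\beta(a)x$ ($a\in A$) and $xy=\rho yx+v$. The automorphism $\gamma$ is part of the data. When $n=0$ in (ii), there are no $b_i$, condition (a) is vacuous and the sum in (b) is empty. *)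

(* Defs.v *)
From HB Require Import structures.
From mathcomp Require Import all_boot all_algebra.

Set Implicit Arguments.
Unset Strict Implicit.
Unset Printing Implicit Defensive.

Import GRing.Theory.
Local Open Scope ring_scope.

(* Ideals are Prop-valued, since A need not have decidable subsets. *)

Record is_ideal (A : nzRingType) (I : A -> Prop) : Prop := IsIdeal {
  ideal0 : I 0;
  idealB : forall a b, I a -> I b -> I (a - b);
  idealMl : forall a b, I b -> I (a * b);
  idealMr : forall a b, I a -> I (a * b)
}.

Definition is_simple (A : nzRingType) : Prop :=
  forall I : A -> Prop, is_ideal I ->
    (forall a, I a <-> a = 0) \/ (forall a, I a).

Definition is_map_ideal (A : nzRingType) (f : A -> A) (I : A -> Prop) : Prop :=
  is_ideal I /\ forall a, I a -> I (f a).

Definition is_map_simple (A : nzRingType) (f : A -> A) : Prop :=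
  forall I : A -> Prop, is_map_ideal f I ->
    (forall a, I a <-> a = 0) \/ (forall a, I a).

Definition is_unit (A : nzRingType) (a : A) : Prop :=
  exists b, a * b = 1 /\ b * a = 1.

Definition is_normal (A : nzRingType) (theta : A -> A) (c : A) : Prop :=
  (forall a, c * a = theta a * c) /\ theta c = c.

(* The inverse is stored as data so that it is available without choice. *)
Record algAut (F : fieldType) (A : algType F) := AlgAut {
  aut_fun :> {lrmorphism A -> A};
  aut_inv : A -> A;
  aut_funK : cancel aut_fun aut_inv;
  aut_invK : cancel aut_inv aut_fun
}.

Record skewDerivation (A : nzRingType) (s : {rmorphism A -> A}) :=
  SkewDerivation {
    sder_fun :> {additive A -> A};
    sderM : forall a b, sder_fun (a * b) = s a * sder_fun b + sder_fun a * b
  }.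

Lemma sder1 (A : nzRingType) (s : {rmorphism A -> A}) (d : skewDerivation s) :
  d 1 = 0.
Proof.
have := sderM d 1 1; rewrite rmorph1 !mulr1 mul1r => d1D.
by apply: (addIr (d 1)); rewrite add0r -d1D.
Qed.

(* The Ore extension A[X; s, d], with coefficients on the left and
   X a = s(a) X + d(a): the underlying left A-module is that of {poly A}, and
   ore_shift is left multiplication by X. *)

Definition ore (A : nzRingType) (s : {rmorphism A -> A})
  (d : skewDerivation s) : Type := {poly A}.

Section OreExtension.

Variables (A : nzRingType) (s : {rmorphism A -> A}) (d : skewDerivation s).

Local Notation ore := (@ore A s d).

HB.instance Definition _ := GRing.Lmodule.copy ore {poly A}.

Definition ore_mon (a : A) (i : nat) : ore := (a *: 'X^i : {poly A}).
Definition ore_C (a : A) : ore := a%:P.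
Definition ore_X : ore := 'X.

Definition ore_shift (q : ore) : ore :=
  map_poly s q * 'X + map_poly d q :> {poly A}.

Definition ore_mul (p q : ore) : ore :=
  \sum_(i < size (p : {poly A})) (p : {poly A})`_i *: iter i ore_shift q.

Lemma ore_shiftD : {morph ore_shift : p q / p + q}.
Proof.
by move=> p q; rewrite /ore_shift !raddfD /= mulrDl addrACA.
Qed.

Lemma ore_shift0 : ore_shift 0 = 0.
Proof. by apply: (addIr (ore_shift 0)); rewrite -ore_shiftD !add0r. Qed.

Lemma ore_shiftZ a q :
  ore_shift (a *: q) = s a *: ore_shift q + d a *: q.
Proof.
rewrite /ore_shift; apply/polyP=> i.
rewrite !(coefD, coefZ, coefMX, coef_map) /= sderM.
by case: i => [|i] /=; rewrite ?coef_map ?coefZ ?rmorphM ?mulr0 ?add0r //= mulrDr addrA.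
Qed.

Lemma iter_ore_shiftD i : {morph iter i ore_shift : p q / p + q}.
Proof. by elim: i => [|i IH] p q //; rewrite !iterS IH ore_shiftD. Qed.

Lemma iter_ore_shift0 i : iter i ore_shift 0 = 0.
Proof. by elim: i => //= i ->; rewrite ore_shift0. Qed.

Lemma ore_mul_widen n (p q : ore) : (size (p : {poly A}) <= n)%N ->
  ore_mul p q = \sum_(i < n) (p : {poly A})`_i *: iter i ore_shift q.
Proof.
move=> le_pn; rewrite /ore_mul.
rewrite (big_ord_widen n (fun i => (p : {poly A})`_i *: iter i ore_shift q)) //.
rewrite big_mkcond; apply: eq_bigr => i _; case: ltnP => // le_pi.
by rewrite nth_default // scale0r.
Qed.

Lemma ore_mulDl : left_distributive ore_mul +%R.
Proof.
move=> p q r; pose n := maxn (size (p : {poly A})) (size (q : {poly A})).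
rewrite (@ore_mul_widen n) ?(@ore_mul_widen n p) ?(@ore_mul_widen n q);
  rewrite ?leq_maxl ?leq_maxr ?size_polyD //.
by rewrite -big_split; apply: eq_bigr => i _; rewrite coefD scalerDl.
Qed.

Lemma ore_mulDr : right_distributive ore_mul +%R.
Proof.
move=> p q r; rewrite /ore_mul -big_split; apply: eq_bigr => i _.
by rewrite iter_ore_shiftD scalerDr.
Qed.

Lemma ore_mul0l q : ore_mul 0 q = 0.
Proof. by apply: (addIr (ore_mul 0 q)); rewrite -ore_mulDl !add0r. Qed.

Lemma ore_mul0r q : ore_mul q 0 = 0.
Proof. by apply: (addIr (ore_mul q 0)); rewrite -ore_mulDr !add0r. Qed.

Lemma ore_mulZl a p q : ore_mul (a *: p) q = a *: ore_mul p q.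
Proof.
rewrite (@ore_mul_widen (size (p : {poly A}))) ?size_scale_leq //.
rewrite scaler_sumr; apply: eq_bigr => i _.
by rewrite coefZ scalerA.
Qed.

Lemma ore_mul_mon a i q : ore_mul (ore_mon a i) q = a *: iter i ore_shift q.
Proof.
rewrite ore_mulZl (@ore_mul_widen i.+1) ?size_polyXn //.
rewrite big_ord_recr /= coefXn eqxx scale1r big1 ?add0r // => j _.
by rewrite coefXn ltn_eqF ?scale0r.
Qed.

Lemma ore_ind (P : ore -> Prop) : P 0 -> (forall p q, P p -> P q -> P (p + q)) ->
  (forall a i, P (ore_mon a i)) -> forall p, P p.
Proof.
move=> P0 PD Pm p; rewrite -[p](@coefK A) poly_def.
by apply: (big_ind P) => // i _; apply: Pm.
Qed.

Lemma ore_shift_mon a i :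
  ore_shift (ore_mon a i) = ore_mon (s a) i.+1 + ore_mon (d a) i.
Proof.
rewrite ore_shiftZ; congr (_ *: _ + _).
rewrite /ore_shift map_polyXn exprSr; apply/polyP=> j.
rewrite coefD coef_map coefXn /=.
suff -> : d (j == i)%:R = 0 by rewrite addr0.
case: eqP => _; last exact: raddf0.
exact: sder1.
Qed.

Lemma ore_mul_shift p q : ore_mul (ore_shift p) q = ore_shift (ore_mul p q).
Proof.
elim/ore_ind: p => [|p1 p2 IH1 IH2|a i].
- by rewrite ore_shift0 ore_mul0l ore_shift0.
- by rewrite ore_shiftD 2!ore_mulDl ore_shiftD IH1 IH2.
- by rewrite ore_shift_mon ore_mulDl !ore_mul_mon ore_shiftZ -iterS.
Qed.

Lemma ore_mulA : associative ore_mul.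
Proof.
move=> p q r; elim/ore_ind: p => [|p1 p2 IH1 IH2|a i].
- by rewrite !ore_mul0l.
- by rewrite !ore_mulDl IH1 IH2.
rewrite !ore_mul_mon ore_mulZl; congr (_ *: _).
by elim: i => //= i ->; rewrite ore_mul_shift.
Qed.

Lemma ore_mul1l : left_id (ore_C 1) ore_mul.
Proof.
move=> q; have -> : ore_C 1 = ore_mon 1 0 by rewrite /ore_mon scale1r.
by rewrite ore_mul_mon scale1r.
Qed.

Lemma ore_mul1r : right_id (ore_C 1) ore_mul.
Proof.
have iter1 i : iter i ore_shift (ore_C 1) = ore_mon 1 i.
  elim: i => [|i IH]; first by rewrite /ore_mon scale1r.
  by rewrite iterS IH ore_shift_mon rmorph1 sder1 /ore_mon scale0r addr0.
move=> p; elim/ore_ind: p => [|p1 p2 IH1 IH2|a i].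
- exact: ore_mul0l.
- by rewrite ore_mulDl IH1 IH2.
- by rewrite ore_mul_mon iter1 /ore_mon scalerA mulr1.
Qed.

Lemma ore_one_neq0 : ore_C 1 != 0.
Proof. exact: (oner_neq0 {poly A}). Qed.

HB.instance Definition _ := GRing.Zmodule_isNzRing.Build ore
  ore_mulA ore_mul1l ore_mul1r ore_mulDl ore_mulDr ore_one_neq0.

Lemma ore_monM a i (q : ore) : ore_mon a i * q = a *: iter i ore_shift q.
Proof. exact: ore_mul_mon. Qed.

Lemma ore_monE a i : ore_mon a i = ore_C a * ore_X ^+ i.
Proof.
have Xn j : ore_X ^+ j = ore_mon 1 j.
  elim: j => [|j IH]; first by rewrite /ore_mon scale1r.
  have XE : ore_X = ore_mon 1 1 by rewrite /ore_mon scale1r expr1.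
  rewrite exprS IH XE ore_monM scale1r /= ore_shift_mon rmorph1 sder1.
  by rewrite /ore_mon scale0r addr0.
have CE : ore_C a = ore_mon a 0 by rewrite /ore_mon expr0 alg_polyC.
by rewrite Xn CE ore_monM /ore_mon /= scalerA mulr1.
Qed.

Lemma ore_XC a : ore_X * ore_C a = ore_C (s a) * ore_X + ore_C (d a).
Proof.
have C0 b : ore_C b = ore_mon b 0 by rewrite /ore_mon expr0 alg_polyC.
rewrite -[X in _ = _ * X + _]expr1 -ore_monE !C0.
have -> : ore_X = ore_mon 1 1 by rewrite /ore_mon scale1r expr1.
by rewrite ore_monM scale1r /= ore_shift_mon.
Qed.

Lemma ore_CE a : ore_C a = ore_mon a 0.
Proof. by rewrite /ore_mon expr0 alg_polyC. Qed.

Lemma ore_C0 : ore_C 0 = 0.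
Proof. exact: polyC0. Qed.

Lemma ore_XE : ore_X = ore_mon 1 1.
Proof. by rewrite /ore_mon scale1r expr1. Qed.

Lemma ore_CM a b : ore_C (a * b) = ore_C a * ore_C b.
Proof. by rewrite !ore_CE ore_monM /ore_mon /= scalerA. Qed.

End OreExtension.

Record ambiskewData (F : fieldType) (A : algType F) := AmbiskewData {
  askew_alpha : algAut A;
  askew_gamma : algAut A;
  askew_v : A;
  askew_rho : F;
  askew_rho_neq0 : askew_rho != 0;
  askew_v_normal : is_normal askew_gamma askew_v;
  askew_comm : forall a,
    askew_alpha (askew_gamma a) = askew_gamma (askew_alpha a)
}.

Fact null_skewM (A : nzRingType) (s : {rmorphism A -> A}) (a b : A) :
  (\0 : {additive A -> A}) (a * b) = s a * (\0 : {additive A -> A}) b +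
    (\0 : {additive A -> A}) a * b.
Proof. by rewrite /= mulr0 mul0r addr0. Qed.

Definition null_skewDerivation (A : nzRingType) (s : {rmorphism A -> A}) :
  skewDerivation s := SkewDerivation (null_skewM s).

Section Ambiskew.

Variables (F : fieldType) (A : algType F) (D : ambiskewData A).

Local Notation alpha := (askew_alpha D).
Local Notation gamma := (askew_gamma D).
Local Notation v := (askew_v D).
Local Notation rho := (askew_rho D).

Definition askew_vm (m : nat) : A := \sum_(l < m) rho ^+ l *: iter l alpha v.

Definition askew_beta (a : A) : A := aut_inv alpha (gamma a).

Lemma alpha_beta a : alpha (askew_beta a) = gamma a.
Proof. exact: aut_invK. Qed.

Lemma beta_alpha a : askew_beta (alpha a) = gamma a.
Proof. by rewrite /askew_beta -askew_comm aut_funK. Qed.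

Lemma askew_beta_bij : bijective askew_beta.
Proof.
exists (fun a => aut_inv gamma (alpha a)) => a.
  by rewrite alpha_beta aut_funK.
by rewrite /askew_beta aut_invK aut_funK.
Qed.

Fact askew_beta_is_zmod_morphism : zmod_morphism askew_beta.
Proof.
move=> a b; apply: (can_inj (aut_funK alpha)).
by rewrite [RHS]raddfB /= !alpha_beta raddfB.
Qed.

Fact askew_beta_is_monoid_morphism : monoid_morphism askew_beta.
Proof.
split=> [|a b]; apply: (can_inj (aut_funK alpha)).
  by rewrite alpha_beta !rmorph1.
by rewrite [RHS]rmorphM /= !alpha_beta rmorphM.
Qed.

HB.instance Definition _ :=
  GRing.isZmodMorphism.Build A A askew_beta askew_beta_is_zmod_morphism.
HB.instance Definition _ :=
  GRing.isMonoidMorphism.Build A A askew_beta askew_beta_is_monoid_morphism.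

Definition askew_poly : nzRingType :=
  ore (null_skewDerivation (alpha : {rmorphism A -> A})).

Local Notation mon := (ore_mon (null_skewDerivation alpha)).

(* The extension of beta to A[y; alpha] with beta(y) = rho y. *)
Definition askew_betay (p : askew_poly) : askew_poly :=
  \poly_(i < size (p : {poly A}))
     (rho ^+ i *: askew_beta (p : {poly A})`_i) :> {poly A}.

(* The beta-derivation with delta(A) = 0 and delta(y) = v; by the Leibniz rule,
   delta(a y^i) = beta(a) (sum_(l < i) rho^l alpha^l(v)) y^(i - 1). *)
Definition askew_deltay (p : askew_poly) : askew_poly :=
  \poly_(i < size (p : {poly A}))
     (askew_beta (p : {poly A})`_i.+1 * askew_vm i.+1) :> {poly A}.

Lemma coef_betay (p : askew_poly) i : (askew_betay p : {poly A})`_i =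
  rho ^+ i *: askew_beta (p : {poly A})`_i.
Proof.
rewrite coef_poly; case: ltnP => // le_pi.
by rewrite nth_default // raddf0 scaler0.
Qed.

Lemma coef_deltay (p : askew_poly) i : (askew_deltay p : {poly A})`_i =
  askew_beta (p : {poly A})`_i.+1 * askew_vm i.+1.
Proof.
rewrite coef_poly; case: ltnP => // le_pi.
by rewrite nth_default ?raddf0 ?mul0r // ltnW.
Qed.

Fact askew_betay_is_zmod_morphism : zmod_morphism askew_betay.
Proof.
move=> p q; apply/polyP=> i.
by rewrite coef_betay !coefB !coef_betay raddfB scalerBr.
Qed.

Fact askew_deltay_is_zmod_morphism : zmod_morphism askew_deltay.
Proof.
move=> p q; apply/polyP=> i.
by rewrite coef_deltay !coefB !coef_deltay raddfB mulrBl.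
Qed.

HB.instance Definition _ := GRing.isZmodMorphism.Build
  askew_poly askew_poly askew_betay askew_betay_is_zmod_morphism.
HB.instance Definition _ := GRing.isZmodMorphism.Build
  askew_poly askew_poly askew_deltay askew_deltay_is_zmod_morphism.

Lemma askew_betay_mon a i :
  askew_betay (mon a i) = mon (rho ^+ i *: askew_beta a) i.
Proof.
apply/polyP=> j; rewrite coef_betay !coefZ !coefXn.
by case: eqP => [->|_]; rewrite ?mulr1 // !mulr0 raddf0 scaler0.
Qed.

Lemma askew_vm0 : askew_vm 0 = 0.
Proof. by rewrite /askew_vm big_ord0. Qed.

Lemma askew_deltay_mon a i :
  askew_deltay (mon a i) = mon (askew_beta a * askew_vm i) i.-1.
Proof.
apply/polyP=> j; rewrite coef_deltay !coefZ !coefXn.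
case: i => [|i] /=; first by rewrite mulr0 raddf0 askew_vm0 mulr0 !mul0r.
by rewrite eqSS; case: eqP => [->|_]; rewrite ?mulr1 // !mulr0 raddf0 mul0r.
Qed.

Lemma mon_mul a i b j : mon a i * mon b j = mon (a * iter i alpha b) (i + j).
Proof.
rewrite ore_monM /ore_mon -scalerA; congr (_ *: _).
elim: i => [//|i IH]; rewrite !iterS IH.
by rewrite [LHS]ore_shift_mon /ore_mon scale0r addr0.
Qed.

Lemma iter_alphaZ c i a : iter i alpha (c *: a) = c *: iter i alpha a.
Proof. by elim: i => //= i ->; rewrite linearZ. Qed.

Lemma iter_alphaM i a b : iter i alpha (a * b) = iter i alpha a * iter i alpha b.
Proof. by elim: i => //= i ->; rewrite rmorphM. Qed.

Lemma iter_alpha_beta i a : iter i alpha (askew_beta a) = askew_beta (iter i alpha a).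
Proof. by elim: i => //= i ->; rewrite alpha_beta beta_alpha. Qed.

Lemma iter_alpha_sum i n (f : 'I_n -> A) :
  iter i alpha (\sum_k f k) = \sum_k iter i alpha (f k).
Proof. by elim: i => //= i ->; rewrite raddf_sum. Qed.

Lemma iter_alpha_v l a : iter l alpha v * a = gamma a * iter l alpha v.
Proof.
elim: l a => [|l IH] a /=; first by case: (askew_v_normal D) => ->.
rewrite -{1}(aut_invK alpha a) -rmorphM IH rmorphM /=.
by rewrite askew_comm aut_invK.
Qed.

Lemma askew_vm_comm m a : askew_vm m * a = gamma a * askew_vm m.
Proof.
rewrite mulr_suml mulr_sumr; apply: eq_bigr => l _.
by rewrite -scalerAl iter_alpha_v scalerAr.
Qed.

Lemma askew_vmD i j :
  askew_vm (i + j) = askew_vm i + rho ^+ i *: iter i alpha (askew_vm j).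
Proof.
rewrite /askew_vm big_split_ord /= iter_alpha_sum scaler_sumr; congr (_ + _).
by apply: eq_bigr => l _; rewrite iter_alphaZ scalerA -exprD -iterD.
Qed.

Fact askew_betay_is_monoid_morphism : monoid_morphism askew_betay.
Proof.
have mon1 : (1 : askew_poly) = mon 1 0 by rewrite /ore_mon scale1r.
split; first by rewrite mon1 askew_betay_mon expr0 scale1r rmorph1.
move=> p q; elim/ore_ind: p => [|p1 p2 IH1 IH2|a i].
- by rewrite raddf0 !mul0r raddf0.
- by rewrite mulrDl !raddfD /= IH1 IH2 mulrDl.
elim/ore_ind: q => [|q1 q2 IH1 IH2|b j].
- by rewrite raddf0 !mulr0 raddf0.
- by rewrite mulrDr !raddfD /= IH1 IH2 mulrDr.
rewrite mon_mul !askew_betay_mon mon_mul; congr (mon _ _).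
by rewrite rmorphM iter_alphaZ iter_alpha_beta -scalerAl -scalerAr scalerA exprD.
Qed.

HB.instance Definition _ := GRing.isMonoidMorphism.Build
  askew_poly askew_poly askew_betay askew_betay_is_monoid_morphism.

Fact askew_deltayM (p q : askew_poly) : askew_deltay (p * q) =
  askew_betay p * askew_deltay q + askew_deltay p * q.
Proof.
elim/ore_ind: p => [|p1 p2 IH1 IH2|a i].
- by rewrite !raddf0 !mul0r raddf0 addr0.
- by rewrite mulrDl !raddfD /= IH1 IH2 !mulrDl addrACA.
elim/ore_ind: q => [|q1 q2 IH1 IH2|b j].
- by rewrite !raddf0 !mulr0 raddf0 addr0.
- by rewrite mulrDr !raddfD /= IH1 IH2 !mulrDr addrACA.
rewrite mon_mul askew_betay_mon !askew_deltay_mon !mon_mul.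
have -> : mon (rho ^+ i *: askew_beta a * iter i alpha (askew_beta b * askew_vm j))
      (i + j.-1) =
    mon (askew_beta (a * iter i alpha b) *
      (rho ^+ i *: iter i alpha (askew_vm j))) (i + j).-1.
  case: j => [|j] /=; last first.
    by rewrite addnS -scalerAl -scalerAr iter_alphaM iter_alpha_beta rmorphM !mulrA.
  have -> : iter i alpha (askew_vm 0) = 0.
    by rewrite askew_vm0; elim: i => //= i ->; rewrite raddf0.
  rewrite iter_alphaM askew_vm0.
  have -> : iter i alpha 0 = 0 by elim: i => //= i ->; rewrite raddf0.
  by rewrite scaler0 !mulr0 /ore_mon !scale0r.
have -> : mon (askew_beta a * askew_vm i * iter i.-1 alpha b) (i.-1 + j) =
    mon (askew_beta (a * iter i alpha b) * askew_vm i) (i + j).-1.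
  case: i => [|i] /=; first by rewrite askew_vm0 !mulr0 mul0r /ore_mon !scale0r.
  by rewrite -mulrA askew_vm_comm rmorphM /= beta_alpha mulrA.
by rewrite -[RHS]scalerDl -mulrDr addrC -askew_vmD.
Qed.

Definition askew_delta : skewDerivation (askew_betay : {rmorphism _ -> _}) :=
  SkewDerivation askew_deltayM.

(* R(A, alpha, v, rho) = A[y; alpha][x; beta, delta] *)
Definition ambiskew : nzRingType := ore askew_delta.

Definition ambiskew_C (a : A) : ambiskew :=
  ore_C askew_delta (ore_C (null_skewDerivation alpha) a).
Definition ambiskew_y : ambiskew :=
  ore_C askew_delta (ore_X (null_skewDerivation alpha)).
Definition ambiskew_x : ambiskew := ore_X askew_delta.

Lemma askew_betay_C a : askew_betay (ore_C _ a) = ore_C _ (askew_beta a).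
Proof. by rewrite !ore_CE askew_betay_mon expr0 scale1r. Qed.

Lemma askew_betay_y :
  askew_betay (ore_X _) = ore_C _ rho%:A * ore_X (null_skewDerivation alpha).
Proof.
by rewrite -[X in _ * X]expr1 -ore_monE ore_XE askew_betay_mon rmorph1 expr1.
Qed.

Lemma askew_deltay_C a : askew_deltay (ore_C _ a) = 0.
Proof. by rewrite ore_CE askew_deltay_mon askew_vm0 mulr0 /ore_mon scale0r. Qed.

Lemma askew_deltay_y : askew_deltay (ore_X _) = ore_C _ v.
Proof.
rewrite ore_XE askew_deltay_mon rmorph1 mul1r /askew_vm big_ord_recl big_ord0.
by rewrite expr0 scale1r addr0 ore_CE.
Qed.

Lemma ambiskew_yC a :
  ambiskew_y * ambiskew_C a = ambiskew_C (alpha a) * ambiskew_y.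
Proof.
rewrite -!ore_CM ore_XC; congr (ore_C _ _).
by rewrite [X in _ + X]ore_C0 addr0.
Qed.

Lemma ambiskew_xC a :
  ambiskew_x * ambiskew_C a = ambiskew_C (askew_beta a) * ambiskew_x.
Proof.
rewrite [LHS]ore_XC /= askew_betay_C askew_deltay_C.
by rewrite [X in _ + X]ore_C0 addr0.
Qed.

Lemma ambiskew_xy : ambiskew_x * ambiskew_y =
  ambiskew_C rho%:A * ambiskew_y * ambiskew_x + ambiskew_C v.
Proof. by rewrite [LHS]ore_XC /= askew_betay_y askew_deltay_y ore_CM. Qed.

End Ambiskew.

(* Main.v *)
(* Put w = xy. After inverting y the ambiskew polynomial ring becomes the skew
   Laurent extension B[y, y^-1; tau] of B = A[w; gamma], where tau extends alpha
   and tau(w) = rho^-1 (w - v).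

   If v is a unit and A is alpha-simple, a proper nonzero tau-ideal of B of least
   degree yields a monic f with f a = gamma^d(a) f, w f = f w and
   tau(f) = rho^-d f. The divided derivatives of f inherit these relations, and
   alpha-simplicity makes their leading coefficients units; taking f of least
   positive degree, all the derivatives are constant, so in characteristic p f is
   a p-polynomial plus a constant, i.e. the data excluded by (ii). Hence B is
   tau-simple. A polynomial in y over B of least degree in a tau-ideal, with
   constant term 1, commutes with w, and comparing coefficients through
   tau^k(w) = rho^-k (w - v^(k)) makes it equal to 1; so every nonzero ideal contains
   a power of y, and x y^m - rho^m y^m x = v^(m) y^(m-1) brings it down to 1.

   Conversely, data as in (ii) give an element of B that is normal in the whole ring
   and has positive degree in x, hence generates a proper nonzero ideal. *)
Require Import Defs.
From HB Require Import structures.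
From mathcomp Require Import all_boot all_algebra.
From Stdlib Require Import Classical.

Set Implicit Arguments.
Unset Strict Implicit.
Unset Printing Implicit Defensive.

Import GRing.Theory.
Local Open Scope ring_scope.

(** * Ore extensions: degrees, ideals of coefficients, evaluation *)

Section OreTheory.

Variables (A : nzRingType) (s : {rmorphism A -> A}) (d : skewDerivation s).

Local Notation O := (ore d).
Local Notation X := (ore_X d).
Local Notation C := (ore_C d).

Fact ore_C_is_zmod_morphism : zmod_morphism C.
Proof. exact: polyCB. Qed.

Fact ore_C_is_monoid_morphism : monoid_morphism C.
Proof. by split=> // a b; apply: ore_CM. Qed.

HB.instance Definition _ :=
  GRing.isZmodMorphism.Build A O C ore_C_is_zmod_morphism.
HB.instance Definition _ :=
  GRing.isMonoidMorphism.Build A O C ore_C_is_monoid_morphism.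

Lemma ore_CMl a (q : O) : C a * q = a *: q.
Proof. by rewrite ore_CE ore_monM. Qed.

Lemma coef_ore_CM a (q : O) i : (C a * q : {poly A})`_i = a * (q : {poly A})`_i.
Proof. by rewrite ore_CMl coefZ. Qed.

(** With coefficients written on the left, a right factor [X] never meets [s] or [d], so the product
    is that of ordinary polynomials. *)
Lemma ore_MX (q : O) : q * X = (q : {poly A}) * 'X.
Proof.
elim/ore_ind: q => [|p q IHp IHq|a i].
- by rewrite !mul0r.
- by rewrite mulrDl IHp IHq; apply/esym/(mulrDl (p : {poly A})).
by rewrite -[RHS]scalerAl -exprSr ore_monE -mulrA -exprSr -ore_monE.
Qed.

Lemma ore_MXn (q : O) n : q * X ^+ n = (q : {poly A}) * 'X^n.
Proof.
elim: n => [|n IH]; first by rewrite !expr0 !mulr1.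
by rewrite !exprSr !mulrA ore_MX IH.
Qed.

Lemma ore_XM (q : O) : X * q = ore_shift q.
Proof. by rewrite ore_XE ore_monM scale1r. Qed.

Lemma ore_XnM n (q : O) : X ^+ n * q = iter n (@ore_shift _ _ d) q.
Proof. by elim: n => [|n IH]; rewrite ?mul1r // exprS -mulrA IH ore_XM. Qed.

Lemma coef0_ore_XM (q : O) : (X * q : {poly A})`_0 = d (q : {poly A})`_0.
Proof. by rewrite ore_XM /ore_shift coefD coefMX !coef_map /= add0r. Qed.

Lemma coefS_ore_XM (q : O) i : (X * q : {poly A})`_i.+1 =
  s (q : {poly A})`_i + d (q : {poly A})`_i.+1.
Proof. by rewrite ore_XM /ore_shift coefD coefMX !coef_map. Qed.

Lemma ore_ME (p q : O) :
  p * q = \sum_(i < size (p : {poly A})) C (p : {poly A})`_i * (X ^+ i * q).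
Proof. by apply: eq_bigr => i _; rewrite ore_CMl ore_XnM. Qed.

(** In X a = s(a) X + d(a) only the first term raises the degree, so [d] never reaches the top
    coefficient. Bounds replace exact degrees because leading coefficients may vanish. *)
Lemma ore_iter_XM_coef n m (q : O) : (size (q : {poly A}) <= m.+1)%N ->
  (size ((X ^+ n * q)%R : {poly A}) <= (n + m).+1)%N /\
  (X ^+ n * q : {poly A})`_(n + m) = iter n s (q : {poly A})`_m.
Proof.
move=> le_q; elim: n => [|n [IHs IHc]]; first by rewrite mul1r.
rewrite exprS -mulrA addSn coefS_ore_XM IHc; split; last first.
  by rewrite [X in d X]nth_default // raddf0 addr0.
apply/leq_sizeP => -[|i] //; rewrite ltnS => le_i; rewrite coefS_ore_XM.
by rewrite !nth_default ?raddf0 ?addr0 // ?(leq_trans IHs) // ltnW.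
Qed.

Lemma ore_sizeM m n (p q : O) : (size (p : {poly A}) <= m.+1)%N ->
  (size (q : {poly A}) <= n.+1)%N ->
  (size ((p * q)%R : {poly A}) <= (m + n).+1)%N.
Proof.
move=> le_p le_q; rewrite ore_ME; apply: (leq_trans (size_sum _ _ _)).
apply/bigmax_leqP => i _; rewrite ore_CMl.
apply: leq_trans (size_scale_leq _ _) _.
apply: leq_trans (ore_iter_XM_coef i le_q).1 _.
by rewrite ltnS leq_add2r -ltnS (leq_trans (ltn_ord i)).
Qed.

Lemma ore_coefM_top m n (p q : O) : (size (p : {poly A}) <= m.+1)%N ->
  (size (q : {poly A}) <= n.+1)%N ->
  (p * q : {poly A})`_(m + n) =
    (p : {poly A})`_m * iter m s (q : {poly A})`_n.
Proof.
move=> le_p le_q.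
have -> : p * q = \sum_(i < m.+1) C (p : {poly A})`_i * (X ^+ i * q).
  rewrite [LHS](@ore_mul_widen _ _ _ m.+1 p q le_p); apply: eq_bigr => i _.
  by rewrite ore_CMl ore_XnM.
rewrite coef_sum big_ord_recr /= coef_ore_CM (ore_iter_XM_coef m le_q).2.
rewrite big1 ?add0r // => i _; rewrite coef_ore_CM [X in _ * X]nth_default ?mulr0 //.
by apply: leq_trans (ore_iter_XM_coef i le_q).1 _; rewrite ltn_add2r.
Qed.

Lemma ideal_add (R : nzRingType) (I : R -> Prop) a b :
  is_ideal I -> I a -> I b -> I (a + b).
Proof.
by move=> [I0 IB _ _] Ia Ib; rewrite -[b]opprK; apply: (IB) => //; rewrite -sub0r; apply: IB.
Qed.

Lemma ideal_sum (R : nzRingType) (I : R -> Prop) n (f : 'I_n -> R) :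
  is_ideal I -> (forall i, I (f i)) -> I (\sum_i f i).
Proof.
by move=> idI If; apply: (big_ind I) => //; [apply: ideal0|move=> a b; apply: ideal_add].
Qed.

(* Coefficients are written on the left, so right multiplication preserves an
   ideal of coefficients with no stability hypothesis. *)
Lemma ore_coef_ideal (I : A -> Prop) : is_ideal I ->
  (forall a, I a -> I (s a)) -> (forall a, I a -> I (d a)) ->
  is_ideal (fun p : O => forall i, I (p : {poly A})`_i).
Proof.
move=> idI Is Id; have [I0 IB Il Ir] := idI.
split=> [i|p q Ip Iq i|p q Iq i|p q Ip i].
- by rewrite coef0.
- by rewrite coefB; apply: (IB).
- rewrite ore_ME coef_sum; apply: ideal_sum => // j.
  rewrite coef_ore_CM; apply: Il.
  elim: (nat_of_ord j) i => [|k IH] i; first by rewrite mul1r.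
  rewrite exprS -mulrA; case: i => [|i]; first by rewrite coef0_ore_XM; apply: Id.
  by rewrite coefS_ore_XM; apply: ideal_add => //; [apply: Is|apply: Id].
- rewrite ore_ME coef_sum; apply: ideal_sum => // j.
  by rewrite coef_ore_CM; apply: Ir.
Qed.

Section Eval.

Variables (R : nzRingType) (psi : {rmorphism A -> R}) (t : R).

Definition ore_eval (p : O) : R :=
  \sum_(i < size (p : {poly A})) psi (p : {poly A})`_i * t ^+ i.

Lemma ore_eval_widen n (p : O) : (size (p : {poly A}) <= n)%N ->
  ore_eval p = \sum_(i < n) psi (p : {poly A})`_i * t ^+ i.
Proof.
move=> le_pn; rewrite /ore_eval.
rewrite (big_ord_widen n (fun i => psi (p : {poly A})`_i * t ^+ i)) //.
rewrite big_mkcond; apply: eq_bigr => i _; case: ltnP => // le_pi.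
by rewrite nth_default // raddf0 mul0r.
Qed.

Fact ore_eval_is_zmod_morphism : zmod_morphism ore_eval.
Proof.
move=> p q; pose n := maxn (size (p : {poly A})) (size (q : {poly A})).
rewrite (@ore_eval_widen n) ?(@ore_eval_widen n p) ?(@ore_eval_widen n q);
  rewrite ?leq_maxl ?leq_maxr ?(leq_trans (size_polyD _ _)) ?size_polyN //.
by rewrite -sumrB; apply: eq_bigr => i _; rewrite coefB raddfB mulrBl.
Qed.

HB.instance Definition _ :=
  GRing.isZmodMorphism.Build O R ore_eval ore_eval_is_zmod_morphism.

Lemma ore_eval_mon a i : ore_eval (ore_mon d a i) = psi a * t ^+ i.
Proof.
rewrite (@ore_eval_widen i.+1); last first.
  by rewrite (leq_trans (size_scale_leq _ _)) ?size_polyXn.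
rewrite big_ord_recr /= coefZ coefXn eqxx mulr1 big1 ?add0r // => j _.
by rewrite coefZ coefXn ltn_eqF ?mulr0 ?raddf0 ?mul0r.
Qed.

Lemma ore_evalC a : ore_eval (C a) = psi a.
Proof. by rewrite ore_CE ore_eval_mon mulr1. Qed.

Lemma ore_evalX : ore_eval X = t.
Proof. by rewrite ore_XE ore_eval_mon rmorph1 mul1r. Qed.

Hypothesis ore_evalP : forall a, t * psi a = psi (s a) * t + psi (d a).

(** The universal property of the Ore extension: [ore_evalP] makes evaluation compatible with a left
    factor [X], and left factors [X] and constants generate all others. *)
Fact ore_eval_is_monoid_morphism : monoid_morphism ore_eval.
Proof.
split; first by rewrite -[1]/(C 1) ore_evalC rmorph1.
have evalXM q : ore_eval (X * q) = t * ore_eval q.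
  elim/ore_ind: q => [|p q IHp IHq|a i]; first by rewrite mulr0 !raddf0 mulr0.
    by rewrite mulrDr !raddfD /= IHp IHq mulrDr.
  rewrite ore_XM ore_shift_mon raddfD /= !ore_eval_mon mulrA ore_evalP mulrDl.
  by rewrite exprS mulrA.
move=> p q; elim/ore_ind: p => [|p1 p2 IH1 IH2|a i].
- by rewrite mul0r !raddf0 mul0r.
- by rewrite mulrDl !raddfD /= IH1 IH2 mulrDl.
have evalZ b r : ore_eval (C b * r) = psi b * ore_eval r.
  elim/ore_ind: r => [|r1 r2 IH1 IH2|c j]; first by rewrite mulr0 !raddf0 mulr0.
    by rewrite mulrDr !raddfD /= IH1 IH2 mulrDr.
  by rewrite ore_monE mulrA -rmorphM -!ore_monE !ore_eval_mon rmorphM mulrA.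
rewrite ore_eval_mon ore_monE -mulrA evalZ -mulrA; congr (_ * _).
elim: i => [|i IH]; first by rewrite !mul1r.
by rewrite !exprS -!mulrA evalXM IH.
Qed.

End Eval.

End OreTheory.

(** * Ore extensions with zero derivation *)

Section NullOre.

Variables (A : nzRingType) (s : {rmorphism A -> A}).

Local Notation d := (null_skewDerivation s).
Local Notation O := (ore d).
Local Notation X := (ore_X d).
Local Notation C := (ore_C d).

Lemma coef_null_XM (q : O) i :
  (X * q : {poly A})`_i = if i is j.+1 then s (q : {poly A})`_j else 0.
Proof. by case: i => [|i]; rewrite ?coef0_ore_XM ?coefS_ore_XM /= ?addr0. Qed.

Lemma null_XC a : X * C a = C (s a) * X.
Proof. by rewrite ore_XC /= [X in _ + X]ore_C0 addr0. Qed.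

Lemma null_XnC n a : X ^+ n * C a = C (iter n s a) * X ^+ n.
Proof.
elim: n => [|n IH]; first by rewrite mul1r mulr1.
by rewrite exprS -mulrA IH mulrA null_XC -mulrA.
Qed.

Lemma coef_null_MC (q : O) a i :
  (q * C a : {poly A})`_i = (q : {poly A})`_i * iter i s a.
Proof.
elim/ore_ind: q => [|p q IHp IHq|b j].
- by rewrite mul0r !coef0 mul0r.
- by rewrite mulrDl !coefD IHp IHq mulrDl.
rewrite ore_monE -mulrA null_XnC mulrA -rmorphM -!ore_monE /ore_mon !coefZ !coefXn.
by case: eqP => [->|_]; rewrite !(mulr1, mulr0, mul0r).
Qed.

End NullOre.

(** * The ring A[w; gamma], its automorphism tau, and its map to R *)

Section AmbiskewBase.

Variables (F : fieldType) (A : algType F) (D : ambiskewData A).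

Local Notation alpha := (askew_alpha D).
Local Notation gamma := (askew_gamma D).
Local Notation v := (askew_v D).
Local Notation rho := (askew_rho D).
Local Notation R := (ambiskew D).
Local Notation cst := (ambiskew_C D).
Local Notation x := (ambiskew_x D).
Local Notation y := (ambiskew_y D).

Lemma gamma_v : gamma v = v.
Proof. by case: (askew_v_normal D). Qed.

Lemma v_normal a : v * a = gamma a * v.
Proof. by case: (askew_v_normal D). Qed.

Fact ambiskew_C_is_zmod_morphism : zmod_morphism cst.
Proof. by move=> a b; rewrite /ambiskew_C !raddfB. Qed.

Fact ambiskew_C_is_monoid_morphism : monoid_morphism cst.
Proof. by split=> [|a b]; rewrite /ambiskew_C ?rmorph1 ?rmorphM. Qed.

HB.instance Definition _ :=
  GRing.isZmodMorphism.Build A R cst ambiskew_C_is_zmod_morphism.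
HB.instance Definition _ :=
  GRing.isMonoidMorphism.Build A R cst ambiskew_C_is_monoid_morphism.

Lemma algC_comm (c : F) (a : A) : c%:A * a = a * c%:A.
Proof. by rewrite -scalerAl mul1r -scalerAr mulr1. Qed.

Lemma rhoVA n : (rho ^- n)%:A * (rho ^+ n)%:A = 1 :> A.
Proof.
by rewrite -scalerAl mul1r scalerA mulVf ?scale1r ?expf_neq0 ?askew_rho_neq0.
Qed.

Lemma rhoAV n : (rho ^+ n)%:A * (rho ^- n)%:A = 1 :> A.
Proof. by rewrite algC_comm rhoVA. Qed.

Lemma askew_beta_scalar (c : F) : askew_beta D c%:A = c%:A.
Proof.
apply: (can_inj (aut_funK alpha)).
by rewrite alpha_beta !rmorph_alg.
Qed.

(** [ambiskew] carries only a ring structure, so scalars of F enter as [cst c%:A]. They are central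
    because alpha and beta fix them, so that they commute with A, x and y. *)
Lemma cst_algC_comm (c : F) (r : R) : cst c%:A * r = r * cst c%:A.
Proof.
have cy : GRing.comm (cst c%:A) y by rewrite /GRing.comm ambiskew_yC rmorph_alg.
have cx : GRing.comm (cst c%:A) x by rewrite /GRing.comm ambiskew_xC askew_beta_scalar.
have cC a : GRing.comm (cst c%:A) (cst a).
  by rewrite /GRing.comm -!rmorphM algC_comm.
elim/ore_ind: r => [|r1 r2 IH1 IH2|q j]; first exact: commr0.
  exact: commrD.
rewrite ore_monE; apply: commrM; last exact: (commrX j cx).
elim/ore_ind: q => [|q1 q2 IH1 IH2|a i].
- by rewrite raddf0; apply: commr0.
- by rewrite raddfD; apply: commrD.
by rewrite ore_monE rmorphM rmorphXn; exact: (commrM (cC a) (commrX i cy)).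
Qed.

(* The subring A[w; gamma] generated by A and w = xy. *)
Definition askew0 : nzRingType :=
  ore (null_skewDerivation (gamma : {rmorphism A -> A})).

Local Notation B := askew0.
Local Notation w := (ore_X (null_skewDerivation (gamma : {rmorphism A -> A}))).
Local Notation C := (ore_C (null_skewDerivation (gamma : {rmorphism A -> A}))).

Lemma w_comm_v : GRing.comm (C v) w.
Proof. by rewrite /GRing.comm null_XC /= gamma_v. Qed.

Definition askew_tauw : B := C (rho^-1)%:A * (w - C v).

(* Conjugation by y. *)
Definition askew_tau : B -> B :=
  @ore_eval _ _ (null_skewDerivation (gamma : {rmorphism A -> A})) B
    (C \o alpha : {rmorphism A -> B}) askew_tauw.

(** The relation w a = gamma(a) w survives the substitution because v is gamma-normal and alpha
    commutes with gamma. *)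
Fact askew_tauP a : askew_tauw * (C \o alpha) a =
  (C \o alpha) (gamma a) * askew_tauw + (C \o alpha) ((\0 : {additive A -> A}) a).
Proof.
rewrite /= raddf0 [C 0]ore_C0 addr0 /askew_tauw -mulrA mulrBl null_XC.
rewrite -[C v * _]ore_CM v_normal askew_comm rmorphM -mulrBr !mulrA.
by rewrite -!ore_CM algC_comm.
Qed.

HB.instance Definition _ := GRing.isZmodMorphism.Build B B askew_tau
  (@ore_eval_is_zmod_morphism _ _ _ _ _ _).
HB.instance Definition _ := GRing.isMonoidMorphism.Build B B askew_tau
  (@ore_eval_is_monoid_morphism _ _
    (null_skewDerivation (gamma : {rmorphism A -> A})) _ _ _ askew_tauP).

Local Notation tau := askew_tau.

Lemma tauC a : tau (C a) = C (alpha a).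
Proof. exact: ore_evalC. Qed.

Lemma tauw : tau w = askew_tauw.
Proof. exact: ore_evalX. Qed.

Lemma tau_surj b : exists c, tau c = b.
Proof.
(* Solving tau(w) = rho^-1 (w - v) for w gives the preimage rho w + alpha^-1(v). *)
have tauw_inv : tau (C rho%:A * w + C (aut_inv alpha v)) = w.
  rewrite rmorphD rmorphM /= !tauC tauw rmorph_alg aut_invK /askew_tauw mulrA.
  by rewrite -ore_CM -[rho]expr1 rhoAV rmorph1 mul1r subrK.
elim/ore_ind: b => [|b1 b2 [c1 <-] [c2 <-]|a i]; first by exists 0; rewrite raddf0.
  by exists (c1 + c2); rewrite raddfD.
exists (C (aut_inv alpha a) * (C rho%:A * w + C (aut_inv alpha v)) ^+ i).
by rewrite rmorphM rmorphXn /= tauC aut_invK tauw_inv -ore_monE.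
Qed.

Lemma iter_tau_surj n b : exists c, iter n tau c = b.
Proof.
elim: n b => [|n IH] b; first by exists b.
by have [c <-] := tau_surj b; have [c' <-] := IH c; exists c'.
Qed.

Lemma askew_vm1 : askew_vm D 1 = v.
Proof. by rewrite /askew_vm big_ord1 scale1r. Qed.

(** Induction through v^(n+1) = v + rho alpha(v^(n)); this is how the elements v^(n) enter. *)
Lemma iter_tauw n : iter n tau w = C (rho ^- n)%:A * (w - C (askew_vm D n)).
Proof.
elim: n => [|n IH]; first by rewrite askew_vm0 [C 0]ore_C0 subr0 invr1 scale1r mul1r.
rewrite iterS IH rmorphM raddfB /= !tauC tauw rmorph_alg /askew_tauw.
have -> : (rho ^- n.+1)%:A = (rho ^- n)%:A * (rho^-1)%:A :> A.
  by rewrite -scalerAl mul1r scalerA -invfM -exprSr.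
rewrite rmorphM -mulrA; congr (_ * _).
rewrite -add1n askew_vmD askew_vm1 rmorphD opprD addrA [in RHS]mulrBr; congr (_ - _).
rewrite -ore_CM expr1 mulr_algl scalerA mulVf ?scale1r //.
exact: askew_rho_neq0.
Qed.

(** Since gamma(v) = v, [C v] commutes with [w], and the powers of tau(w) expand by the binomial
    theorem. *)
Lemma coef_tau n j (f : B) : (size (f : {poly A}) <= n)%N ->
  (tau f : {poly A})`_j = \sum_(i < n)
    rho ^- i *: (alpha (f : {poly A})`_i * (- v) ^+ (i - j) *+ 'C(i, j)).
Proof.
move=> le_f; rewrite /tau (ore_eval_widen _ _ le_f) coef_sum.
apply: eq_bigr => i _; rewrite /= coef_ore_CM.
have -> : askew_tauw ^+ i = C (rho ^- i)%:A * (C (- v) + w) ^+ i.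
  rewrite /askew_tauw exprMn_comm; last first.
    apply: commrB; rewrite /GRing.comm; first by rewrite null_XC /= rmorph_alg.
    by rewrite -!ore_CM algC_comm.
  by rewrite -rmorphXn /= exprZn expr1n exprVn raddfN addrC.
rewrite exprDn_comm; last by rewrite raddfN; apply/commr_sym/commrN/commr_sym/w_comm_v.
rewrite coef_ore_CM coef_sum mulr_algl -scalerAr -mulrnAr; congr (_ *: (_ * _)).
have E k : (C (- v) ^+ (i - k) * w ^+ k *+ 'C(i, k) : {poly A})`_j =
    if k == j then (- v) ^+ (i - j) *+ 'C(i, j) else 0.
  rewrite coefMn -rmorphXn -ore_monE /ore_mon coefZ coefXn eq_sym.
  by case: eqP => [->|_]; rewrite ?mulr1 // mulr0 mul0rn.
under eq_bigr => k _ do rewrite E.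
rewrite -big_mkcond /=; case: (ltnP j i.+1) => [lt_ji|lt_ij].
  by rewrite (big_pred1 (Ordinal lt_ji)).
by rewrite bin_small // big_pred0 // => k; rewrite ltn_eqF // (leq_trans (ltn_ord k)).
Qed.

Lemma ambiskew_yx : y * x = cst (rho^-1)%:A * (x * y - cst v).
Proof.
rewrite ambiskew_xy addrK !mulrA -rmorphM -[rho]expr1 rhoVA.
by rewrite rmorph1 mul1r.
Qed.

Fact askew0_evalP a :
  (x * y) * cst a = cst (gamma a) * (x * y) + cst ((\0 : {additive A -> A}) a).
Proof.
rewrite /= raddf0 addr0 -mulrA ambiskew_yC mulrA ambiskew_xC beta_alpha.
by rewrite mulrA.
Qed.

Definition askew0_eval : B -> R :=
  @ore_eval _ _ (null_skewDerivation (gamma : {rmorphism A -> A})) R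
    (cst : {rmorphism A -> R}) (x * y).

HB.instance Definition _ := GRing.isZmodMorphism.Build B R askew0_eval
  (@ore_eval_is_zmod_morphism _ _ _ _ _ _).
HB.instance Definition _ := GRing.isMonoidMorphism.Build B R askew0_eval
  (@ore_eval_is_monoid_morphism _ _
    (null_skewDerivation (gamma : {rmorphism A -> A})) _ _ _ askew0_evalP).

Local Notation phi0 := askew0_eval.

Lemma phi0C a : phi0 (C a) = cst a.
Proof. exact: ore_evalC. Qed.

Lemma phi0w : phi0 w = x * y.
Proof. exact: ore_evalX. Qed.

Lemma phi0_tauw : phi0 askew_tauw = y * x.
Proof. by rewrite /askew_tauw rmorphM raddfB /= !phi0C phi0w ambiskew_yx. Qed.

(** On constants this is y a = alpha(a) y; on w it is y (x y) = (y x) y, where y x is the image of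
    tau(w). *)
Lemma y_phi0 b : y * phi0 b = phi0 (tau b) * y.
Proof.
elim/ore_ind: b => [|b c IHb IHc|a i].
- by rewrite !raddf0 mulr0 mul0r.
- by rewrite !raddfD mulrDl mulrDr IHb IHc.
rewrite ore_monE !rmorphM !rmorphXn /= tauC tauw !phi0C phi0w phi0_tauw.
rewrite mulrA ambiskew_yC -!mulrA; congr (_ * _).
elim: i => [|i IH]; first by rewrite mulr1 mul1r.
by rewrite !exprSr mulrA IH -!mulrA.
Qed.

(* Conjugation by x involves the inverse of alpha, but on elements fixed
   coefficientwise by gamma it is inverse to conjugation by y. *)
Lemma phi0_x (b : B) : (forall i, gamma (b : {poly A})`_i = (b : {poly A})`_i) ->
  phi0 b * x = x * phi0 (tau b).
Proof.
move=> gb; have -> : b = \sum_(i < size (b : {poly A})) C (b : {poly A})`_i * w ^+ i.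
  by rewrite -[LHS]mulr1 [LHS]ore_ME; apply: eq_bigr => i _; rewrite mulr1.
rewrite [tau _]rmorph_sum /= !rmorph_sum /= mulr_suml mulr_sumr.
apply: eq_bigr => i _; rewrite !rmorphM !rmorphXn /= tauC tauw.
rewrite !phi0C phi0w phi0_tauw mulrA ambiskew_xC beta_alpha gb -!mulrA.
congr (_ * _); elim: (nat_of_ord i) => [|k IH]; first by rewrite mulr1 mul1r.
by rewrite !exprS -!mulrA IH !mulrA.
Qed.

Lemma yn_phi0 n b : y ^+ n * phi0 b = phi0 (iter n tau b) * y ^+ n.
Proof.
elim: n b => [|n IH] b; first by rewrite mul1r mulr1.
by rewrite exprS -mulrA IH mulrA y_phi0 -mulrA -exprS.
Qed.

End AmbiskewBase.

(** * Binomial coefficients modulo p *)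

Section BinomialPchar.

Variables (F : fieldType) (p : nat).
Hypothesis hp : p \in [pchar F].

Lemma coef_1DX_exp n k : ((1 + 'X) ^+ n : {poly F})`_k = 'C(n, k)%:R.
Proof.
rewrite exprDn coef_sum.
under eq_bigr => i _ do rewrite expr1n mul1r coefMn coefXn eq_sym mulrb.
have [le_kn|lt_nk] := leqP k n.
  rewrite (bigD1 (Ordinal (le_kn : (k < n.+1)%N))) //= eqxx.
  rewrite big1 ?addr0 // => i; rewrite -val_eqE /= => /negPf->.
  by rewrite mul0rn.
rewrite bin_small // big1 // => i _; rewrite ltn_eqF ?mul0rn //.
by rewrite (leq_trans (ltn_ord i)).
Qed.

Lemma pX_pchar (L : lalgType F) n : [pchar L].-nat (p ^ n)%N.
Proof.
have prp := pcharf_prime hp; apply/pnatP; first by rewrite expn_gt0 prime_gt0.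
move=> q prq; rewrite Euclid_dvdX // => /andP[/(prime_nt_dvdP _)]/= Ep _.
by rewrite Ep ?(pchar_lalg L) // neq_ltn prime_gt1 ?orbT.
Qed.

(** Both sides are the coefficient of X^(p^e) in (1 + X)^(p^e m) = (1 + X^(p^e))^m. *)
Lemma bin_pX_mul e m : 'C(p ^ e * m, p ^ e)%:R = m%:R :> F.
Proof.
rewrite -coef_1DX_exp exprM exprDn_pchar ?pX_pchar // expr1n.
have -> : (1 + 'X^(p ^ e)) ^+ m = ((1 + 'X) ^+ m : {poly F}) \Po 'X^(p ^ e).
  by rewrite rmorphXn rmorphD /= comp_polyX rmorph1.
have p_gt0 : (0 < p ^ e)%N by rewrite expn_gt0 prime_gt0 ?(pcharf_prime hp).
by rewrite coef_comp_poly_Xn // dvdnn divnn p_gt0 coef_1DX_exp bin1.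
Qed.

(** Write i = p^e m with m prime to p. If m > 1, then k = p^e lies strictly between 0 and i, and its
    binomial is m, which is nonzero in F. *)
Lemma bin_eq0_pX i : (0 < i)%N ->
  (forall k, (0 < k < i)%N -> 'C(i, k)%:R = 0 :> F) -> i = (p ^ logn p i)%N.
Proof.
move=> i_gt0 C0; have prp := pcharf_prime hp.
have [m pm Ei] := pfactor_coprime prp i_gt0.
move: Ei; rewrite mulnC; set e := logn p i => Ei.
case: m pm Ei => [|[|m]] pm Ei; first by rewrite Ei muln0 in i_gt0.
  by rewrite muln1 in Ei.
have pe_gt0 : (0 < p ^ e)%N by rewrite expn_gt0 prime_gt0.
have := C0 (p ^ e)%N; rewrite {2}Ei bin_pX_mul {1}Ei pe_gt0 ltn_Pmulr //.
move=> /(_ isT)/eqP; rewrite -(dvdn_pcharf hp) => pm'.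
by rewrite prime_coprime // pm' in pm.
Qed.

End BinomialPchar.

(** This lets divided derivatives pass through the binomial expansion that computes tau. *)
Lemma mul_bin_bin k i j :
  ('C(k + i, k) * 'C(i, j) = 'C(k + i, k + j) * 'C(k + j, k))%N.
Proof.
have [le_ji|lt_ij] := leqP j i; last first.
  by rewrite (bin_small lt_ij) muln0 bin_small // ltn_add2l.
apply/eqP; rewrite -(@eqn_pmul2r (k`! * (j`! * (i - j)`!))); last first.
  by rewrite !muln_gt0 !fact_gt0.
have fact_add l : ('C(k + l, k) * (k`! * l`!) = (k + l)`!)%N.
  by rewrite -(bin_fact (leq_addr l k)) addKn.
apply/eqP; rewrite mulnACA (bin_fact le_ji) -[LHS]mulnA -[RHS]mulnA (mulnA k`!) (mulnA 'C(k + j, k)).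
by rewrite !fact_add -(subnDl k i j) bin_fact ?leq_add2l.
Qed.

(** * Shift-normal polynomials: derivatives and leading coefficients *)

Section ShiftNormal.

Variables (F : fieldType) (A : algType F) (D : ambiskewData A).

Local Notation alpha := (askew_alpha D).
Local Notation gamma := (askew_gamma D).
Local Notation v := (askew_v D).
Local Notation rho := (askew_rho D).

Lemma iter_gamma_fix n a : gamma a = a -> iter n gamma a = a.
Proof. by move=> ga; elim: n => //= n ->. Qed.

Lemma iter_gammaM n : {morph iter n gamma : a b / a * b}.
Proof. by elim: n => // n IH a b; rewrite !iterS IH rmorphM. Qed.

Lemma iter_gammaVK n : cancel (iter n (aut_inv gamma)) (iter n gamma).
Proof. by elim: n => // n IH a; rewrite iterSr iterS aut_invK IH. Qed.

(** For a left inverse a, u a = theta(a) u = theta(a) theta(u) = theta(a u) = 1. *)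
Lemma normal_left_inverse theta (u a : A) : {morph theta : b c / b * c} ->
  theta 1 = 1 -> (forall b, u * b = theta b * u) -> theta u = u ->
  a * u = 1 -> u * a = 1.
Proof. by move=> tM t1 un tu au; rewrite un -[X in _ * X]tu -tM au t1. Qed.

(* The commutation relations satisfied, in A[w; gamma], by an element
   f of degree at most s with f a = gamma^s(a) f, w f = f w and
   tau(f) = rho^-s f, read off on coefficients. *)
Definition shift_normal s (f : {poly A}) := [/\
  forall i, gamma f`_i = f`_i,
  forall i a, f`_i * a = iter (s - i) gamma a * f`_i,
  (size f <= s.+1)%N &
  forall j, \sum_(i < s.+1) rho ^- i *:
      (alpha f`_i * (- v) ^+ (i - j) *+ 'C(i, j)) = rho ^- s *: f`_j].

(** Coefficient j of the derivative is an integer multiple of coefficient k + j of f, so each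
    relation is inherited from index k + j. In the tau relation the terms of index below k have zero
    binomial. *)
Lemma shift_normal_nderivn k s f :
  shift_normal (k + s) f -> shift_normal s f^`N(k).
Proof.
move=> [fg fn fs ft]; split=> [i|i a||j].
- by rewrite coef_nderivn raddfMn /= fg.
- by rewrite coef_nderivn mulrnAl mulrnAr fn subnDl.
- apply/leq_sizeP => i lt_i; rewrite coef_nderivn nth_default ?mul0rn //.
  by rewrite (leq_trans fs) // ltn_add2l.
have := ft (k + j)%N; rewrite -addnS big_split_ord /=.
rewrite big1 ?add0r => [Ej|i _]; last first.
  by rewrite bin_small ?mulr0n ?scaler0 // ltn_addr.
transitivity (rho ^+ k *: (rho ^- (k + s) *: f`_(k + j) *+ 'C(k + j, k))); last first.
  rewrite coef_nderivn scalerMnr scalerA; congr (_ *: _).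
  by rewrite exprD invfM mulrA divff ?mul1r // expf_neq0 ?askew_rho_neq0.
rewrite -Ej -sumrMnl scaler_sumr; apply: eq_bigr => i _.
rewrite scalerMnr scalerA exprD invfM mulrA divff ?expf_neq0 ?askew_rho_neq0 // mul1r.
congr (_ *: _); rewrite coef_nderivn raddfMn /= mulrnAl -!mulrnA subnDl.
by rewrite mul_bin_bin.
Qed.

Lemma shift_normal_lead s (f : {poly A}) (m := (size f).-1) : shift_normal s f ->
  alpha (lead_coef f) = (rho ^+ m * rho ^- s) *: lead_coef f.
Proof.
move=> [fg fn fs ft]; have := ft m.
have lt_ms : (m < s.+1)%N by rewrite /m; case: (size f) fs => // n /ltnW.
rewrite (bigD1 (Ordinal lt_ms)) //= subnn mulr1 binn mulr1n big1 ?addr0; last first.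
  move=> i; rewrite -val_eqE /= neq_ltn => /orP[lt_i|lt_i].
    by rewrite bin_small ?mulr0n ?scaler0.
  rewrite nth_default ?raddf0 ?mul0r ?mul0rn ?scaler0 //.
  by rewrite -ltnS /m in lt_i *; case: (size f) lt_i.
move=> Em; rewrite -scalerA -[lead_coef f]/(f`_m) -Em scalerA divff ?scale1r //.
by rewrite expf_neq0 ?askew_rho_neq0.
Qed.

Hypothesis alpha_simple : is_map_simple alpha.

(** The leading coefficient e is normal and alpha(e) is a scalar multiple of e, so A e is a nonzero
    two-sided alpha-ideal and contains 1. *)
Lemma shift_normal_lead_unit s f : f != 0 -> shift_normal s f ->
  is_unit (lead_coef f).
Proof.
move=> f_neq0 sf; have [fg fn _ _] := sf; set e := lead_coef f.
have en a : e * a = iter (s - (size f).-1) gamma a * e by apply: fn.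
have ge : gamma e = e by apply: fg.
case: (alpha_simple (I := fun a => exists b, a = b * e)).
- split; last first.
    move=> _ [b ->]; exists (alpha b * (rho ^+ (size f).-1 * rho ^- s)%:A).
    by rewrite rmorphM /= (shift_normal_lead sf) -mulrA mulr_algl.
  split=> [|_ _ [a ->] [b ->]|a _ [b ->]|_ b [a ->]].
  + by exists 0; rewrite mul0r.
  + by exists (a - b); rewrite mulrBl.
  + by exists (a * b); rewrite mulrA.
  + by exists (a * iter (s - (size f).-1) gamma b); rewrite -!mulrA en.
- move=> /(_ e)[e0 _]; have /eqP : e = 0 by apply: e0; exists 1; rewrite mul1r.
  by rewrite lead_coef_eq0 (negPf f_neq0).
move=> /(_ 1)[a ae]; exists a; split=> //.
apply: (normal_left_inverse _ _ en) => //; first exact: iter_gammaM.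
  by elim: (s - _)%N => //= n ->; rewrite rmorph1.
exact: iter_gamma_fix.
Qed.

(** Multiply f by the inverse e' of its leading coefficient: e' is gamma-fixed, twists by the
    inverse of gamma^(s - m) and scales inversely under alpha, so the parameter s drops to the
    degree m of f. *)
Lemma shift_normal_monic s f : f != 0 -> shift_normal s f ->
  exists g : {poly A}, [/\ g \is monic, size g = size f &
    shift_normal (size f).-1 g].
Proof.
move=> f_neq0 sf; have [e' [ee e'e]] := shift_normal_lead_unit f_neq0 sf.
have [fg fn fs ft] := sf.
set e := lead_coef f in ee e'e; set m := (size f).-1.
have le_ms : (m <= s)%N by rewrite /m; case: (size f) fs.
have ge : gamma e = e by apply: fg.
have ge' : gamma e' = e'.
  by rewrite -[LHS]mulr1 -ee mulrA -ge -rmorphM e'e rmorph1 mul1r.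
have ae' : alpha e' = (rho ^+ s * rho ^- m) *: e'.
  have rn k : rho ^+ k != 0 by rewrite expf_neq0 ?askew_rho_neq0.
  rewrite -[RHS]mul1r -[X in X * _](rmorph1 alpha) -e'e rmorphM /=.
  rewrite (shift_normal_lead sf) -/e -/m -mulrA; set c := rho ^+ s / _; set c' := rho ^+ m / _.
  have cc' : c' * c = 1 by rewrite /c /c' mulrA mulfVK ?divff.
  by rewrite -scalerAl -!scalerAr ee scalerA cc' scale1r mulr1.
have e'n a : e' * iter (s - m) gamma a = a * e'.
  by rewrite -[LHS]mulr1 -ee -mulrA [X in e' * X]mulrA -fn -/e !mulrA e'e mul1r.
(* A may have zero divisors; the lower bound comes from f = e (e' f). *)
have sizeg : size (e' *: f) = size f.
  apply/eqP; rewrite eqn_leq size_scale_leq /=.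
  rewrite -{1}[f]scale1r -ee -scalerA; exact: size_scale_leq.
exists (e' *: f); split=> //.
  by rewrite monicE lead_coefE sizeg coefZ e'e.
split=> [i|i a||j].
- by rewrite coefZ rmorphM /= ge' fg.
- rewrite coefZ -mulrA fn mulrA.
  have [le_im|lt_mi] := leqP i m; last first.
    by rewrite [f`_i]nth_default ?mulr0 //; move: lt_mi; rewrite /m; case: (size f).
  have -> : (s - i = s - m + (m - i))%N by rewrite addnBA // subnK.
  by rewrite iterD e'n mulrA.
- by rewrite sizeg /m; case: (size f).
transitivity ((rho ^+ s * rho ^- m) *: (e' * (rho ^- s *: f`_j))); last first.
  rewrite coefZ -scalerAr scalerA mulrAC mulrC divff ?mulr1 //.
  by rewrite expf_neq0 ?askew_rho_neq0.
rewrite -ft; have -> : \sum_(i < s.+1) rho ^- i *: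
      (alpha f`_i * (- v) ^+ (i - j) *+ 'C(i, j)) =
    \sum_(i < m.+1) rho ^- i *: (alpha f`_i * (- v) ^+ (i - j) *+ 'C(i, j)).
  rewrite [RHS](big_ord_widen _ (fun i => rho ^- i *:
    (alpha f`_i * (- v) ^+ (i - j) *+ 'C(i, j))) (le_ms : m < s.+1)%N).
  rewrite [RHS]big_mkcond; apply: eq_bigr => i _; case: ltnP => // lt_mi.
  rewrite nth_default ?raddf0 ?mul0r ?mul0rn ?scaler0 //.
  by rewrite (leq_trans _ lt_mi) // /m; case: (size f).
rewrite mulr_sumr scaler_sumr; apply: eq_bigr => i _.
rewrite coefZ rmorphM /= ae' -!scalerAl scalerMnr !scalerA -scalerAr scalerA.
by rewrite mulrnAr (mulrA e'); congr (_ *: _); rewrite mulrC.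
Qed.

End ShiftNormal.

(** * From shift-normal polynomials to p-polynomials *)

Section PPolynomial.

Variables (F : fieldType) (p : nat).
Hypothesis hp : p \in [pchar F].
Variables (A : algType F) (D : ambiskewData A).

Local Notation alpha := (askew_alpha D).
Local Notation gamma := (askew_gamma D).
Local Notation v := (askew_v D).
Local Notation rho := (askew_rho D).

Definition ppoly_datum : Prop :=
  exists (n : nat) (b : 'I_n -> A) (u : A),
    (forall i : 'I_n,
       [/\ gamma (b i) = b i,
           is_normal (iter (p ^ n - p ^ i)%N gamma) (b i) &
           alpha (b i) = rho ^ ((p ^ i)%:Z - (p ^ n)%:Z) *: b i]) /\
    [/\ gamma u = u,
        is_normal (iter (p ^ n)%N gamma) u &
        rho ^+ (p ^ n)%N *: alpha u - u =
          v ^+ (p ^ n)%N + \sum_(i < n) b i * v ^+ (p ^ i)%N].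

(** No power of p lies strictly between p^n and p^(n+1), so each step of the induction adds a single
    term. *)
Lemma sum_pX (V : nmodType) (G : nat -> V) n :
  (forall i, (0 < i)%N -> i <> (p ^ logn p i)%N -> G i = 0) ->
  \sum_(i < p ^ n) G i.+1 = \sum_(l < n.+1) G (p ^ l)%N.
Proof.
move=> G0; have prp := pcharf_prime hp; have p_gt1 := prime_gt1 prp.
rewrite -(big_mkord xpredT (fun i => G i.+1)) -(big_mkord xpredT (fun l => G (p ^ l)%N)).
elim: n => [|n IH]; first by rewrite expn0 !big_nat1.
have lt_pn : (p ^ n < p ^ n.+1)%N by rewrite ltn_exp2l.
rewrite big_nat_recr //= -IH (big_cat_nat (n := (p ^ n)%N)) ?(ltnW lt_pn) //=.
congr (_ + _); case E: (p ^ n.+1)%N lt_pn => [|q] // lt_pn.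
rewrite big_nat_recr //= big_nat_cond big1 ?add0r // => i.
rewrite andbT => /andP[le_i lt_iq]; apply: G0 => // Ei.
have lt_nl : (n < logn p i.+1)%N by rewrite -(ltn_exp2l _ _ p_gt1) -Ei ltnS.
have : (logn p i.+1 < n.+1)%N by rewrite -(ltn_exp2l _ _ p_gt1) -Ei E ltnS.
by rewrite ltnS leqNgt lt_nl.
Qed.

(** The last hypothesis says that the divided derivatives of g of positive order are constant, so g
    is a p-polynomial plus a constant. In the tau relation, degree p^i gives the eigenvalue of b_i
    and degree 0 gives (b). *)
Lemma monic_shift_normal_ppoly d (g : {poly A}) : (0 < d)%N ->
  g \is monic -> size g = d.+1 -> shift_normal D d g ->
  (forall i k, (0 < k < i)%N -> g`_i *+ 'C(i, k) = 0) -> ppoly_datum.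
Proof.
move=> d_gt0 g_monic sg [gg gn _ gt] gC.
have prp := pcharf_prime hp; have p_gt1 := prime_gt1 prp.
have gd : g`_d = 1 by move/monicP: g_monic; rewrite lead_coefE sg.
have rn k : rho ^+ k != 0 by rewrite expf_neq0 ?askew_rho_neq0.
have g0 i : (0 < i)%N -> i <> (p ^ logn p i)%N -> g`_i = 0.
  move=> i_gt0 ip; apply/eqP/negPn/negP => gi; case: ip.
  apply: (bin_eq0_pX hp) => // k lt_k; apply/eqP.
  (* A is a vector space over F, so an integer that kills a nonzero coefficient is zero in F. *)
  have /eqP := gC i k lt_k; rewrite -[_ *+ _](@scaler_nat F A) scaler_eq0.
  by case/orP=> // gi0; rewrite gi0 in gi.
have Ed : d = (p ^ logn p d)%N.
  case: (eqVneq d (p ^ logn p d)%N) => // /eqP dp.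
  by have /eqP := g0 d d_gt0 dp; rewrite gd oner_eq0.
have ag l : (p ^ l <= d)%N ->
    alpha g`_(p ^ l) = (rho ^+ (p ^ l) * rho ^- d) *: g`_(p ^ l).
  move=> le_ld; have := gt (p ^ l)%N.
  rewrite (bigD1 (Ordinal (le_ld : (p ^ l < d.+1)%N))) //= subnn mulr1 binn mulr1n.
  rewrite big1 ?addr0 => [Ea|i].
    by rewrite -scalerA -Ea scalerA divff ?scale1r.
  rewrite -val_eqE /= neq_ltn => /orP[lt_i|lt_i].
    by rewrite bin_small ?mulr0n ?scaler0.
  rewrite -mulrnAl -raddfMn gC ?raddf0 ?mul0r ?scaler0 //.
  by rewrite lt_i expn_gt0 ltnW.
set n := logn p d in Ed.
exists n, (fun i => g`_(p ^ i)), g`_0; split=> [i|].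
  split; first exact: gg.
    by split=> [a|]; [rewrite gn Ed|apply: iter_gamma_fix].
  rewrite ag; last by rewrite Ed leq_exp2l // ltnW.
  by congr (_ *: _); rewrite expfzDr ?askew_rho_neq0 // -exprnN -exprnP Ed.
split; first exact: gg.
  by split=> [a|]; [rewrite gn subn0 Ed|apply: iter_gamma_fix].
have := gt 0%N; rewrite big_ord_recl /= invr1 scale1r subnn mulr1 bin0 mulr1n => E0.
rewrite -Ed -[g`_0 in X in _ - X]scale1r -(divff (rn d)) -scalerA -E0 scalerDr opprD addrA.
rewrite subrr sub0r -scalerN -sumrN scaler_sumr.
transitivity (\sum_(i < d) g`_i.+1 * v ^+ i.+1).
  apply: eq_bigr => i _; rewrite bin0 mulr1n subn0.
  case: (eqVneq i.+1 (p ^ logn p i.+1)%N) => [Ei|/eqP ip]; last first.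
    by rewrite g0 // raddf0 !mul0r scaler0 oppr0 scaler0.
  rewrite /bump /= add1n Ei ag -?Ei ?ltn_ord //.
  (* The exponent is a power of p; the sign rule covers p = 2, where -1 = 1. *)
  have -> : (- v) ^+ i.+1 = - v ^+ i.+1 by rewrite Ei exprNn_pchar ?pX_pchar.
  rewrite mulrN !scalerN opprK -scalerAl !scalerA mulrA mulfVK ?rn //.
  by rewrite divff ?rn // scale1r.
transitivity (\sum_(i < p ^ n) g`_i.+1 * v ^+ i.+1); first by rewrite -Ed.
rewrite (@sum_pX _ (fun i => g`_i * v ^+ i)) => [|i i_gt0 ip]; last first.
  by rewrite g0 ?mul0r.
by rewrite big_ord_recr /= addrC -Ed gd mul1r.
Qed.

(** Induction on the degree. If f is not constant, pass to a monic g of the same degree; its divided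
    derivatives are constant by induction, and g then yields the excluded data. *)
Lemma shift_normal_size s (f : {poly A}) : is_map_simple alpha -> ~ ppoly_datum ->
  shift_normal D s f -> (size f <= 1)%N.
Proof.
move=> alpha_simple no_datum; move: {2}(size f) (leqnn (size f)) => n.
elim: n s f => [|n IH] s f le_fn sf; first exact: leq_trans le_fn _.
have [//|lt_1f] := leqP (size f) 1%N.
have f_neq0 : f != 0 by rewrite -size_poly_gt0 ltnW.
have [g [g_monic sg ng]] := shift_normal_monic alpha_simple f_neq0 sf.
case: no_datum; set d := (size f).-1 in ng.
have d_gt0 : (0 < d)%N by rewrite /d; case: (size f) lt_1f => [|[]].
have sgd : size g = d.+1 by rewrite sg /d; case: (size f) lt_1f.
apply: (monic_shift_normal_ppoly d_gt0 g_monic sgd ng) => i k /andP[k_gt0 lt_ki].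
have [le_id|lt_di] := leqP i d; last by rewrite nth_default ?mul0rn // sgd.
have le_kd : (k <= d)%N by rewrite (leq_trans _ le_id) // ltnW.
have nk : shift_normal D (d - k) g^`N(k).
  by apply: shift_normal_nderivn; rewrite subnKC.
have [_ _ sk _] := nk.
have := IH _ _ _ nk; rewrite (leq_trans sk); last first.
  rewrite -ltnS (leq_trans _ le_fn) // -sg sgd ltnS.
  by rewrite -[X in (_ < X)%N](subnK le_kd) -addn1 leq_add2l.
move=> /(_ isT) /leq_sizeP/(_ (i - k)%N); rewrite subn_gt0 lt_ki => /(_ isT).
by rewrite coef_nderivn subnKC // ltnW.
Qed.

End PPolynomial.

(** [P] will say that an ideal has an element of a given degree, which is not decidable; hence the
    use of excluded middle. *)
Lemma ex_minimal (P : nat -> Prop) : (exists n, P n) ->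
  exists n, P n /\ forall m, (m < n)%N -> ~ P m.
Proof.
move=> [n Pn]; elim/ltn_ind: n Pn => n IH Pn.
have [[m [lt_mn Pm]]|noP] := classic (exists m, (m < n)%N /\ P m).
  exact: IH lt_mn Pm.
by exists n; split=> // m lt_mn Pm; apply: noP; exists m.
Qed.

(** * Simplicity of A[w; gamma] with respect to tau *)

Section TauSimple.

Variables (F : fieldType) (A : algType F) (D : ambiskewData A).

Local Notation alpha := (askew_alpha D).
Local Notation gamma := (askew_gamma D).
Local Notation v := (askew_v D).
Local Notation rho := (askew_rho D).
Local Notation B := (askew0 D).
Local Notation w := (ore_X (null_skewDerivation (gamma : {rmorphism A -> A}))).
Local Notation C := (ore_C (null_skewDerivation (gamma : {rmorphism A -> A}))).
Local Notation tau := (@askew_tau F A D).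

Hypothesis alpha_simple : is_map_simple alpha.
(* Invertibility of v makes every ideal of A[w; gamma] stable under the
   automorphism extending gamma, since that is conjugation by v. *)
Hypothesis v_unit : is_unit v.
Hypothesis normal_size : forall s f, shift_normal D s f -> (size f <= 1)%N.

Lemma size_tau n (b : B) : (size (b : {poly A}) <= n)%N ->
  (size (tau b : {poly A}) <= n)%N.
Proof.
move=> le_b; apply/leq_sizeP => j le_nj; rewrite (coef_tau _ le_b).
by rewrite big1 // => i _; rewrite bin_small ?scaler0 // (leq_trans (ltn_ord i)).
Qed.

Lemma coef_tau_top n (b : B) : (size (b : {poly A}) <= n.+1)%N ->
  (tau b : {poly A})`_n = rho ^- n *: alpha (b : {poly A})`_n.
Proof.
move=> le_b; rewrite (coef_tau _ le_b) big_ord_recr /= subnn mulr1 binn mulr1n.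
by rewrite big1 ?add0r // => i _; rewrite bin_small ?mulr0n ?scaler0.
Qed.

Lemma tau_simple (I : B -> Prop) : is_ideal I -> (forall b, I b -> I (tau b)) ->
  (exists b, I b /\ b <> 0) -> I 1.
Proof.
move=> idI It [b0 [Ib0 b0_neq0]]; have [I0 IB Il Ir] := idI.
have [n [[b [Ib sb]] n_min]] :
    exists n, (exists b : B, I b /\ size (b : {poly A}) = n.+1) /\
      forall m, (m < n)%N -> ~ (exists b : B, I b /\ size (b : {poly A}) = m.+1).
  apply: ex_minimal; exists (size (b0 : {poly A})).-1, b0; split=> //.
  by rewrite prednK // size_poly_gt0; apply/eqP.
have small0 c : I c -> (size (c : {poly A}) <= n)%N -> c = 0.
  move=> Ic; case E: (size (c : {poly A})) => [|m] lt_mn.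
    by apply/eqP; rewrite -size_poly_leq0 E.
  by case: (n_min m lt_mn); exists c.
have top c : I c -> (size (c : {poly A}) <= n.+1)%N -> (c : {poly A})`_n = 0 -> c = 0.
  move=> Ic le_c c0; apply: small0 => //; apply/leq_sizeP => j; rewrite leq_eqVlt.
  by case/orP=> [/eqP<- //|lt_nj]; rewrite nth_default // (leq_trans le_c).
(* The coefficients of w^n in members of I of degree at most n, where n is the least degree of a
   nonzero member; alpha-simplicity puts 1 among them. *)
pose L a := exists c : B, [/\ I c, (size (c : {poly A}) <= n.+1)%N &
  (c : {poly A})`_n = a].
have [f [If sf f1]] : L 1.
  case: (alpha_simple (I := L)).
  - split.
      split=> [|_ _ [c [Ic sc <-]] [c' [Ic' sc' <-]]|a _ [c [Ic sc <-]]|_ a [c [Ic sc <-]]].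
      + by exists 0; rewrite coef0 size_poly0.
      + exists (c - c'); rewrite coefB; split=> //; first exact: IB.
        by rewrite (leq_trans (size_polyD _ _)) // size_polyN geq_max sc.
      + exists (C a * c); rewrite coef_ore_CM; split=> //; first exact: Il.
        by rewrite ore_CMl (leq_trans (size_scale_leq _ _)).
      (* Moving a constant past w^n applies gamma^n, which is undone in advance. *)
      + exists (c * C (iter n (aut_inv gamma) a)).
        rewrite coef_null_MC iter_gammaVK; split=> //; first exact: Ir.
        apply/leq_sizeP => j lt_nj.
        by rewrite coef_null_MC nth_default ?mul0r // (leq_trans sc).
    move=> _ [c [Ic sc <-]]; exists (C (rho ^+ n)%:A * tau c); split.
    + by apply: Il; apply: It.
    + by rewrite ore_CMl (leq_trans (size_scale_leq _ _)) // size_tau.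
    + rewrite coef_ore_CM coef_tau_top // mulr_algl scalerA divff ?scale1r //.
      by rewrite expf_neq0 ?askew_rho_neq0.
  - move=> /(_ (b : {poly A})`_n)[L0 _].
    have /eqP : (b : {poly A})`_n = 0 by apply: L0; exists b; rewrite sb.
    have -> : n = (size (b : {poly A})).-1 by rewrite sb.
    by rewrite -lead_coefE lead_coef_eq0 -size_poly_eq0 sb.
  - by apply.
(* In this relation and the next two, the difference of the sides lies in I and its coefficient of
   w^n cancels, so it is zero by minimality. *)
have fC a : f * C a = C (iter n gamma a) * f.
  apply/eqP; rewrite -subr_eq0; apply/eqP; apply: top.
  - by apply: IB; [apply: Ir|apply: Il].
  - apply/leq_sizeP => j lt_nj; rewrite coefB coef_null_MC coef_ore_CM.
    by rewrite nth_default ?mul0r ?mulr0 ?subr0 // (leq_trans sf).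
  - by rewrite coefB coef_null_MC coef_ore_CM f1 mul1r mulr1 subrr.
have fv : C v * f = f * C v.
  apply/eqP; rewrite -subr_eq0; apply/eqP; apply: top.
  - by apply: IB; [apply: Il|apply: Ir].
  - apply/leq_sizeP => j lt_nj; rewrite coefB coef_null_MC coef_ore_CM.
    by rewrite nth_default ?mul0r ?mulr0 ?subr0 // (leq_trans sf).
  - rewrite coefB coef_null_MC coef_ore_CM f1 mulr1 mul1r.
    by rewrite iter_gamma_fix ?subrr // gamma_v.
have ft : tau f = C (rho ^- n)%:A * f.
  apply/eqP; rewrite -subr_eq0; apply/eqP; apply: top.
  - by apply: IB; [apply: It|apply: Il].
  - apply/leq_sizeP => j lt_nj; rewrite coefB coef_ore_CM !nth_default ?mulr0 ?subrr //.
      by rewrite (leq_trans sf).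
    by rewrite (leq_trans (size_tau sf)).
  - by rewrite coefB coef_ore_CM coef_tau_top // f1 rmorph1 mulr1 subrr.
have nf : shift_normal D n f.
  split=> // [i|i a|j].
  - have := congr1 (fun c : B => (c : {poly A})`_i) fv.
    rewrite coef_null_MC coef_ore_CM iter_gamma_fix ?gamma_v // v_normal.
    (* Commutation with v has become gamma(f_i) v = f_i v, and v cancels. *)
    by have [v' [vv' _]] := v_unit => /(congr1 ( *%R^~ v')); rewrite -!mulrA vv' !mulr1.
  - have [le_in|lt_ni] := leqP i n; last first.
      by rewrite nth_default ?mul0r ?mulr0 // (leq_trans sf).
    have := congr1 (fun c : B => (c : {poly A})`_i) (fC (iter i (aut_inv gamma) a)).
    rewrite coef_null_MC coef_ore_CM iter_gammaVK => ->.
    by rewrite -{1}(subnK le_in) iterD iter_gammaVK.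
  - by rewrite -(coef_tau _ sf) ft coef_ore_CM mulr_algl.
have := normal_size nf => sf1.
have n0 : n = 0%N.
  case: n f1 {sf sb n_min small0 top L fC ft nf} => // n f1.
  by move: (oner_neq0 A); rewrite -f1 nth_default ?eqxx // (leq_trans sf1).
suff <- : f = 1 by [].
by rewrite (size1_polyC sf1) -n0 f1.
Qed.

End TauSimple.

(** * Sufficiency of the three conditions *)

Section Sufficiency.

Variables (F : fieldType) (A : algType F) (D : ambiskewData A).

Local Notation alpha := (askew_alpha D).
Local Notation gamma := (askew_gamma D).
Local Notation v := (askew_v D).
Local Notation rho := (askew_rho D).
Local Notation R := (ambiskew D).
Local Notation cst := (ambiskew_C D).
Local Notation x := (ambiskew_x D).
Local Notation y := (ambiskew_y D).
Local Notation B := (askew0 D).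
Local Notation w := (ore_X (null_skewDerivation (gamma : {rmorphism A -> A}))).
Local Notation C := (ore_C (null_skewDerivation (gamma : {rmorphism A -> A}))).
Local Notation tau := (@askew_tau F A D).
Local Notation phi0 := (@askew0_eval F A D).

Lemma alpha_inj : injective alpha.
Proof. exact: can_inj (aut_funK alpha). Qed.

Lemma gamma_vm n : gamma (askew_vm D n) = askew_vm D n.
Proof.
have gv l : gamma (iter l alpha v) = iter l alpha v.
  by elim: l => [|l IH]; rewrite ?gamma_v // iterS -askew_comm IH.
by rewrite /askew_vm raddf_sum /=; apply: eq_bigr => l _; rewrite linearZ /= gv.
Qed.

Lemma ambiskew_y_lreg (r : R) : y * r = 0 -> r = 0.
Proof.
move=> yr0; apply/polyP => j; apply/polyP => i; rewrite !coef0.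
have := congr1 (fun q : R => (q : {poly askew_poly D})`_j) yr0.
rewrite coef_ore_CM coef0.
move=> /(congr1 (fun q : askew_poly D => (q : {poly A})`_i.+1)).
by rewrite coef_null_XM coef0 /= -[RHS](raddf0 alpha) => /alpha_inj.
Qed.

(** At n = 0 the truncated exponent [n.-1] is harmless because v^(0) = 0. *)
Lemma ambiskew_xyn n : x * y ^+ n =
  cst (rho ^+ n)%:A * y ^+ n * x + cst (askew_vm D n) * y ^+ n.-1.
Proof.
have yE k a : cst a * y ^+ k = ore_C (askew_delta D) (ore_mon (null_skewDerivation alpha) a k).
  by rewrite ore_monE rmorphM rmorphXn.
rewrite !yE -[y ^+ n]mul1r -[1](rmorph1 cst) yE.
rewrite [LHS]ore_XC /= askew_betay_mon askew_deltay_mon.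
by rewrite !rmorph1 mul1r.
Qed.

(* The subring A[w; gamma][y; tau]; inverting y in the ambiskew polynomial ring
   turns it into the skew Laurent extension A[w; gamma][y, y^-1; tau]. *)
Definition askew1 : nzRingType :=
  ore (null_skewDerivation (tau : {rmorphism B -> B})).

Local Notation S := askew1.
Local Notation Y := (ore_X (null_skewDerivation (tau : {rmorphism B -> B}))).
Local Notation K := (ore_C (null_skewDerivation (tau : {rmorphism B -> B}))).

Fact askew1_evalP b :
  y * phi0 b = phi0 (tau b) * y + phi0 ((\0 : {additive B -> B}) b).
Proof. by rewrite y_phi0 /= raddf0 addr0. Qed.

Definition askew1_eval : S -> R :=
  @ore_eval _ _ (null_skewDerivation (tau : {rmorphism B -> B})) R
    (phi0 : {rmorphism B -> R}) y.

HB.instance Definition _ := GRing.isZmodMorphism.Build S R askew1_eval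
  (@ore_eval_is_zmod_morphism _ _ _ _ _ _).
HB.instance Definition _ := GRing.isMonoidMorphism.Build S R askew1_eval
  (@ore_eval_is_monoid_morphism _ _
    (null_skewDerivation (tau : {rmorphism B -> B})) _ _ _ askew1_evalP).

Local Notation phi := askew1_eval.

Lemma phiK b : phi (K b) = phi0 b.
Proof. exact: ore_evalC. Qed.

Lemma phiY : phi Y = y.
Proof. exact: ore_evalX. Qed.

Definition tau_poly (g : S) : S := map_poly tau g.

Lemma coef_tau_poly (g : S) i :
  (tau_poly g : {poly B})`_i = tau (g : {poly B})`_i.
Proof. exact: coef_map. Qed.

Lemma YM (g : S) : Y * g = tau_poly g * Y.
Proof.
apply/polyP => i; rewrite coef_null_XM ore_MX coefMX.
by case: i => [|i] //=; rewrite coef_tau_poly.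
Qed.

Lemma y_phi g : y * phi g = phi (tau_poly g) * y.
Proof. by rewrite -phiY -!rmorphM YM. Qed.

(** Since y x is the image of tau(w), each right factor x is absorbed at the cost of one more y on
    the left. *)
Lemma ambiskew_yn_phi (r : R) : exists n g, y ^+ n * r = phi g.
Proof.
elim/ore_ind: r => [|r1 r2 [n1 [g1 E1]] [n2 [g2 E2]]|q j].
- by exists 0%N, 0; rewrite mulr0 raddf0.
- exists (n1 + n2)%N, (Y ^+ n2 * g1 + Y ^+ n1 * g2).
  rewrite rmorphD !rmorphM !rmorphXn /= phiY -E1 -E2 !mulrA -!exprD.
  by rewrite [(n2 + n1)%N]addnC mulrDr.
rewrite ore_monE; elim: j => [|j [n [g E]]].
  rewrite mulr1; elim/ore_ind: q => [|q1 q2 [n1 [g1 E1]] [n2 [g2 E2]]|a i].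
  - by exists 0%N, 0; rewrite !raddf0 mulr0.
  - exists (n1 + n2)%N, (Y ^+ n2 * g1 + Y ^+ n1 * g2).
    rewrite !rmorphD !rmorphM !rmorphXn /= phiY -E1 -E2 !mulrA -!exprD.
    by rewrite [(n2 + n1)%N]addnC mulrDr.
  exists 0%N, (K (C a) * Y ^+ i).
  by rewrite mul1r ore_monE !rmorphM !rmorphXn /= phiK phiY phi0C.
exists n.+1, (tau_poly g * K (tau w)).
rewrite [_ ^+ j.+1]exprSr [y ^+ _]exprS [ore_C _ _ * _]mulrA -mulrA.
rewrite [y ^+ n * _]mulrA E mulrA y_phi -mulrA.
by rewrite rmorphM /= phiK tauw phi0_tauw.
Qed.

Lemma ambiskew_simple : is_map_simple alpha ->
  (forall s f, shift_normal D s f -> (size f <= 1)%N) ->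
  (forall m, (1 <= m)%N -> is_unit (askew_vm D m)) -> is_simple R.
Proof.
move=> alpha_simple normal_size vm_unit I idI.
have v_unit : is_unit v by rewrite -(askew_vm1 D); apply: vm_unit.
have [I0 IB Il Ir] := idI.
have [[r [Ir0 r_neq0]]|I_eq0] := classic (exists r, I r /\ r <> 0); last first.
  left=> a; split=> [Ia|-> //]; apply: NNPP => a_neq0; apply: I_eq0.
  by exists a.
right=> a; rewrite -[a]mulr1; apply: (Il).
have yI n : I (y ^+ n) -> I 1.
  elim: n => [|n IH] // Iyn; apply: IH.
  have [u [_ uv]] := vm_unit n.+1 isT.
  rewrite -[y ^+ n]mul1r -[1](rmorph1 cst) -uv rmorphM -mulrA; apply: (Il).
  have -> : cst (askew_vm D n.+1) * y ^+ n =
      x * y ^+ n.+1 - cst (rho ^+ n.+1)%:A * y ^+ n.+1 * x.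
    by rewrite ambiskew_xyn addrAC subrr add0r.
  by apply: (IB); [apply: (Il)|apply: (Ir); apply: (Il)].
(* The contraction to A[w; gamma][y; tau] of I localised at the powers of y; the free exponent n
   makes right factors Y cancellable. *)
pose J (g : S) := exists n, I (phi g * y ^+ n).
have JB g h : J g -> J h -> J (g - h).
  move=> [n In] [m Im]; exists (n + m)%N; rewrite raddfB mulrBl; apply: (IB).
    by rewrite exprD mulrA; apply: (Ir).
  by rewrite addnC exprD mulrA; apply: (Ir).
have Jl g h : J h -> J (g * h).
  by move=> [n In]; exists n; rewrite rmorphM -mulrA; apply: (Il).
(* To cross y^n, b is first written as tau^n(b'). *)
have JK g b : J g -> J (g * K b).
  move=> [n In]; exists n; have [b' <-] := iter_tau_surj n b.
  by rewrite rmorphM /= phiK -mulrA -yn_phi0 mulrA; apply: (Ir).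
have JY g : J (g * Y) -> J g.
  by move=> [n]; rewrite rmorphM /= phiY -mulrA -exprS; exists n.+1.
have Jtau g : J g -> J (tau_poly g).
  by move=> [n In]; exists n.+1; rewrite exprS mulrA -y_phi -mulrA; apply: (Il).
have [g0 [Jg0 g0_neq0]] : exists g : S, J g /\ g <> 0.
  have [n [g Eg]] := ambiskew_yn_phi r; exists g; split.
    by exists 0%N; rewrite mulr1 -Eg; apply: (Il).
  move=> g0; apply: r_neq0; move: Eg; rewrite g0 raddf0.
  elim: n => [|n IH]; first by rewrite mul1r.
  by rewrite exprS -mulrA => /ambiskew_y_lreg.
have [n [[g [Jg sg]] n_min]] :
    exists n, (exists g : S, J g /\ size (g : {poly B}) = n.+1) /\
      forall m, (m < n)%N -> ~ (exists g : S, J g /\ size (g : {poly B}) = m.+1).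
  apply: ex_minimal; exists (size (g0 : {poly B})).-1, g0; split=> //.
  by rewrite prednK // size_poly_gt0; apply/eqP.
have small0 c : J c -> (size (c : {poly B}) <= n)%N -> c = 0.
  move=> Jc; case E: (size (c : {poly B})) => [|m] lt_mn.
    by apply/eqP; rewrite -size_poly_leq0 E.
  by case: (n_min m lt_mn); exists c.
(* A member without constant term is c' Y; then c' is in J and has smaller degree, so it is zero. *)
have bot c : J c -> (size (c : {poly B}) <= n.+1)%N -> (c : {poly B})`_0 = 0 -> c = 0.
  move=> Jc le_c c0; pose c' : S := \poly_(i < n) (c : {poly B})`_i.+1.
  have Ec : c = c' * Y.
    apply/polyP => i; rewrite ore_MX coefMX; case: i => [|i] //=.
    by rewrite coef_poly; case: ltnP => // le_ni; rewrite nth_default // (leq_trans le_c).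
  rewrite Ec (small0 c') ?mul0r ?size_poly //.
  by apply: JY; rewrite -Ec.
(* By [bot], members of J of degree at most n are determined by their constant terms, which form a
   nonzero tau-ideal. *)
pose L b := exists c : S, [/\ J c, (size (c : {poly B}) <= n.+1)%N &
  (c : {poly B})`_0 = b].
have [f [Jf sf f1]] : L 1.
  apply: (tau_simple alpha_simple v_unit normal_size (I := L)).
  - split=> [|_ _ [c [Jc sc <-]] [c' [Jc' sc' <-]]|b _ [c [Jc sc <-]]|_ b [c [Jc sc <-]]].
    + exists 0; rewrite coef0 size_poly0; split=> //.
      by rewrite -(subrr g0); apply: JB.
    + exists (c - c'); rewrite coefB; split=> //; first exact: JB.
      by rewrite (leq_trans (size_polyD _ _)) // size_polyN geq_max sc.
    + exists (K b * c); rewrite coef_ore_CM; split=> //; first exact: Jl.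
      by rewrite ore_CMl (leq_trans (size_scale_leq _ _)).
    + exists (c * K b); rewrite coef_null_MC; split=> //; first exact: JK.
      apply/leq_sizeP => j lt_nj.
      by rewrite coef_null_MC nth_default ?mul0r // (leq_trans sc).
  - move=> _ [c [Jc sc <-]]; exists (tau_poly c); rewrite coef_tau_poly; split=> //.
      exact: Jtau.
    by apply: leq_trans sc; apply: size_poly.
  - exists (g : {poly B})`_0; split; first by exists g; rewrite sg.
    by move=> /(bot g Jg); rewrite sg => /(_ (leqnn _)) g_eq0; rewrite g_eq0 size_poly0 in sg.
have fw : K w * f = f * K w.
  apply/eqP; rewrite -subr_eq0; apply/eqP; apply: bot.
  - by apply: JB; [apply: Jl|apply: JK].
  - apply/leq_sizeP => j lt_nj; rewrite coefB coef_null_MC coef_ore_CM.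
    by rewrite nth_default ?mul0r ?mulr0 ?subr0 // (leq_trans sf).
  - by rewrite coefB coef_null_MC coef_ore_CM f1 mul1r mulr1 subrr.
have f_eq1 : f = 1.
  apply/polyP => k; case: k => [|k]; first by rewrite f1 coef1.
  rewrite coef1 /=; have := congr1 (fun c : S => (c : {poly B})`_k.+1) fw.
  rewrite coef_null_MC coef_ore_CM iter_tauw; set b := (f : {poly B})`_k.+1.
  have [u [vu _]] := vm_unit k.+1 isT.
  move=> wb; apply/polyP => i; rewrite coef0.
  (* At Y^(k+1) the relation is w b = b tau^(k+1)(w). If b vanishes below degree j in w, then degree
     j leaves b_j v^(k+1) = 0 up to a nonzero scalar, and v^(k+1) is a unit. *)
  have step j : (forall l, (l < j)%N -> (b : {poly A})`_l = 0) -> (b : {poly A})`_j = 0.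
    move=> b0; have := congr1 (fun c : B => (c : {poly A})`_j) wb.
    rewrite mulrBr -rmorphM mulrBr mulrA coefB ore_MX coefMX !coef_null_MC coef_null_XM.
    have -> : (if j is l.+1 then gamma (b : {poly A})`_l else 0) = 0.
      by case: j b0 => // l b0; rewrite b0 ?raddf0.
    rewrite (_ : (if _ then _ else _) = 0); last first.
      by case: j b0 => // l b0 /=; rewrite b0 ?mul0r.
    rewrite sub0r iter_gamma_fix; last by rewrite mulr_algl linearZ /= gamma_vm.
    rewrite mulr_algl -scalerAr => /eqP; rewrite eq_sym oppr_eq0 scaler_eq0.
    rewrite invr_eq0 expf_eq0 (negPf (askew_rho_neq0 D)) andbF => /eqP bv.
    by rewrite -[LHS]mulr1 -vu mulrA bv mul0r.
  by elim/ltn_ind: i => i IH; apply: step.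
case: Jf => m; rewrite f_eq1 rmorph1 mul1r; exact: yI.
Qed.

End Sufficiency.

(** * Necessity of conditions (i) and (iii) *)

Section Necessity.

Variables (F : fieldType) (A : algType F) (D : ambiskewData A).

Local Notation alpha := (askew_alpha D).
Local Notation gamma := (askew_gamma D).
Local Notation v := (askew_v D).
Local Notation rho := (askew_rho D).
Local Notation R := (ambiskew D).
Local Notation cst := (ambiskew_C D).
Local Notation x := (ambiskew_x D).
Local Notation y := (ambiskew_y D).
Local Notation P := (askew_poly D).
Local Notation PX := (ore_X (null_skewDerivation (alpha : {rmorphism A -> A}))).
Local Notation PC := (ore_C (null_skewDerivation (alpha : {rmorphism A -> A}))).
Local Notation RC := (ore_C (askew_delta D)).

Lemma iter_alpha_gamma n a : iter n alpha (gamma a) = gamma (iter n alpha a).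
Proof. by elim: n => // n IH; rewrite !iterS IH askew_comm. Qed.

Lemma iter_alpha0 n : iter n alpha 0 = 0.
Proof. by elim: n => // n IH; rewrite iterS IH raddf0. Qed.

Lemma iter_alphaB n : {morph iter n alpha : a b / a - b}.
Proof. by elim: n => // n IH a b; rewrite !iterS IH raddfB. Qed.

Lemma coef_null_XnM_small n (q : P) i : (i < n)%N -> (PX ^+ n * q : {poly A})`_i = 0.
Proof.
elim: n i => // n IH i lt_in; rewrite exprS -mulrA coef_null_XM.
by case: i lt_in => // i lt_in; rewrite IH ?raddf0.
Qed.

Lemma ambiskew_yn_neq0 n : y ^+ n <> 0.
Proof.
elim: n => [|n IH] y0; first by have := oner_neq0 R; rewrite -y0 eqxx.
by apply/IH/ambiskew_y_lreg; rewrite -exprS.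
Qed.

(* If u = v^(m) is not a unit then the p with alpha^(m-1-i)(p_i) in A u for
   i < m form a proper submodule of R / R x = A[y; alpha] whose quotient is
   killed by y^m, so the annihilator of the quotient is a proper ideal. *)
Lemma simple_vm_unit m : is_simple R -> is_unit (askew_vm D m.+1).
Proof.
move=> simpleR; set u := askew_vm D m.+1.
(* The coefficient of x^0 identifies R / R x with A[y; alpha], on which x acts as delta. T is the
   preimage of W, and J is the largest ideal of R inside T. *)
pose W (q : P) := forall i, (i < m.+1)%N ->
  exists a, iter (m - i) alpha (q : {poly A})`_i = a * u.
pose T (r : R) := W (r : {poly P})`_0.
pose J (r : R) := forall s, T (r * s).
have WB q1 q2 : W q1 -> W q2 -> W (q1 - q2).
  move=> W1 W2 i lt_im; have [a1 E1] := W1 i lt_im; have [a2 E2] := W2 i lt_im.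
  by exists (a1 - a2); rewrite coefB iter_alphaB E1 E2 mulrBl.
have W0 : W 0 by move=> i _; exists 0; rewrite coef0 iter_alpha0 mul0r.
have WD q1 q2 : W q1 -> W q2 -> W (q1 + q2).
  by move=> W1 W2; rewrite -[q2]opprK; apply: (WB) => //; rewrite -sub0r; apply: (WB).
have WC a q : W q -> W (PC a * q).
  move=> Wq i lt_im; have [c E] := Wq i lt_im; exists (iter (m - i) alpha a * c).
  by rewrite coef_ore_CM iter_alphaM E mulrA.
have WX q : W q -> W (PX * q).
  move=> Wq [|i] lt_im; rewrite coef_null_XM.
    by exists 0; rewrite iter_alpha0 mul0r.
  have [c E] := Wq i (ltnW lt_im); exists c.
  by rewrite -E -iterSr subnSK.
have Wl q1 q : W q -> W (q1 * q).
  move=> Wq; elim/ore_ind: q1 => [|r1 r2 W1 W2|a i].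
  - by rewrite mul0r.
  - by rewrite mulrDl; apply: WD.
  rewrite ore_monE -mulrA; apply: WC.
  by elim: i => [|i IH]; rewrite ?mul1r // exprS -mulrA; apply: WX.
have Wdelta q : W q -> W (askew_deltay q).
  move=> Wq i lt_im; rewrite coef_deltay.
  (* In degree m the new factor v^(m+1) is u itself; below m, the u supplied by degree i + 1 moves
     to the right by normality. *)
  move: lt_im; rewrite ltnS leq_eqVlt => /orP[/eqP->|lt_im].
    by rewrite subnn; exists (askew_beta D (q : {poly A})`_m.+1).
  have [c E] := Wq i.+1 lt_im.
  rewrite iter_alphaM; set t := iter _ alpha (askew_vm D i.+1).
  rewrite -subnSK // iterSr alpha_beta iter_alpha_gamma E rmorphM /=; exists (gamma c * gamma t).
  rewrite gamma_vm -!mulrA; congr (_ * _).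
  exact: askew_vm_comm.
have TB r1 r2 : T r1 -> T r2 -> T (r1 - r2).
  by rewrite /T coefB; apply: WB.
have Tl r s : T s -> T (r * s).
  move=> Ts; elim/ore_ind: r => [|r1 r2 T1 T2|q j].
  - by rewrite mul0r /T coef0.
  - by rewrite mulrDl /T coefD; apply: WD.
  rewrite ore_monE -mulrA /T coef_ore_CM; apply: Wl.
  elim: j => [|j IH]; first by rewrite mul1r.
  by rewrite exprS -mulrA coef0_ore_XM; apply: Wdelta.
have [|J0|J1] := simpleR J.
- split=> [s|r1 r2 J1 J2 s|r1 r2 J2 s|r1 r2 J1 s].
  + by rewrite mul0r /T coef0.
  + by rewrite mulrBl; apply: TB.
  + by rewrite -mulrA; apply: Tl.
  + by rewrite -mulrA.
(* y^(m+1) is in J: the x^0 coefficient of y^(m+1) s has no terms of degree at most m in y. *)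
- case: (@ambiskew_yn_neq0 m.+1); apply/J0 => s.
  rewrite -rmorphXn /T coef_ore_CM => i lt_im; exists 0.
  by rewrite coef_null_XnM_small // iter_alpha0 mul0r.
have := J1 1 1; rewrite mulr1 /T coef1 => /(_ 0%N isT)[a].
rewrite coef1 -[1%:R]/1; have -> : iter (m - 0) alpha 1 = 1.
  by elim: (m - 0)%N => // n IH; rewrite iterS IH rmorph1.
move=> /esym au; exists a; split=> //.
apply: (normal_left_inverse _ _ (askew_vm_comm D m.+1) _ au).
- by move=> b c; rewrite rmorphM.
- by rewrite rmorph1.
- exact: gamma_vm.
Qed.

Lemma simple_alpha_simple : is_simple R -> is_map_simple alpha.
Proof.
move=> simpleR I [idI Ialpha]; have [I0 IB Il Ir] := idI.
have [v' [vv' _]] : is_unit v.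
  by rewrite -(askew_vm1 D); apply: simple_vm_unit.
(* Conjugation by the unit v is gamma. *)
have Igamma a : I a -> I (gamma a).
  by move=> Ia; rewrite -[gamma a]mulr1 -vv' mulrA -v_normal; apply/Ir/Il.
have Iiter n k a : I (iter n alpha a) -> I (iter (k + n) alpha a).
  by move=> Ia; rewrite iterD; elim: k => // k IH; apply: Ialpha.
(* The union of the alpha^-n(I) is stable under alpha and under beta = alpha^-1 gamma, so it induces
   an ideal of R coefficientwise. *)
pose I' a := exists n, I (iter n alpha a).
have idI' : is_ideal I'.
  split=> [|a b [n In] [k Ik]|a b [n In]|a b [n In]].
  - by exists 0%N.
  - exists (n + k)%N; rewrite iter_alphaB; apply: (IB); last exact: Iiter.
    by rewrite addnC; apply: Iiter.
  - by exists n; rewrite iter_alphaM; apply: Il.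
  - by exists n; rewrite iter_alphaM; apply: Ir.
have I'alpha a : I' a -> I' (alpha a).
  by move=> [n In]; exists n; rewrite -iterSr; apply: Ialpha.
have I'beta a : I' a -> I' (askew_beta D a).
  move=> [n In]; exists n.+1; rewrite iterSr alpha_beta iter_alpha_gamma.
  exact: Igamma.
have [I'0 I'B I'l I'r] := idI'.
have idP : is_ideal (fun q : P => forall i, I' (q : {poly A})`_i).
  by apply: ore_coef_ideal.
have [|J0|J1] := simpleR (fun r : R => forall j i, I' ((r : {poly P})`_j : {poly A})`_i).
- apply: (ore_coef_ideal (I := fun q : P => forall i, I' (q : {poly A})`_i)) => // q Iq i /=.
    by rewrite coef_betay -mulr_algl; apply/I'l/I'beta.
  by rewrite coef_deltay; apply/I'r/I'beta.
- left=> a; split=> [Ia|-> //].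
  have /J0 : forall j i, I' ((cst a : {poly P})`_j : {poly A})`_i.
    move=> j i; rewrite coefC; case: (j == 0%N); last by rewrite coef0.
    by rewrite coefC; case: (i == 0%N) => //; exists 0%N.
  move=> /(congr1 (fun r : R => ((r : {poly P})`_0 : {poly A})`_0)).
  by rewrite !coefC.
right=> a; have := J1 1 0%N 0%N; rewrite !coefC /= => -[n In].
rewrite -[a]mulr1; apply: Il; move: In; elim: n => //= n; rewrite -iterS iterSr.
by rewrite rmorph1.
Qed.

End Necessity.

(** * Necessity of condition (ii): a normal element of positive degree *)

Lemma exprB_pX_comm (S : nzRingType) p n (a b : S) : p \in [pchar S] ->
  GRing.comm a b -> (a - b) ^+ (p ^ n) = a ^+ (p ^ n) - b ^+ (p ^ n).
Proof.
move=> hp cab; elim: n => // n IH; rewrite expnSr !exprM IH.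
by apply: (pFrobenius_autB_comm hp); apply/commrX/commr_sym/commrX/commr_sym.
Qed.

Section NormalElement.

Variables (F : fieldType) (A : algType F) (D : ambiskewData A).

Local Notation alpha := (askew_alpha D).
Local Notation gamma := (askew_gamma D).
Local Notation v := (askew_v D).
Local Notation rho := (askew_rho D).
Local Notation R := (ambiskew D).
Local Notation cst := (ambiskew_C D).
Local Notation x := (ambiskew_x D).
Local Notation y := (ambiskew_y D).
Local Notation P := (askew_poly D).
Local Notation B := (askew0 D).
Local Notation w := (ore_X (null_skewDerivation (gamma : {rmorphism A -> A}))).
Local Notation C := (ore_C (null_skewDerivation (gamma : {rmorphism A -> A}))).
Local Notation tau := (@askew_tau F A D).
Local Notation phi0 := (@askew0_eval F A D).
Local Notation Pmon := (ore_mon (null_skewDerivation (alpha : {rmorphism A -> A}))).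

Lemma iter_betay_mon n (e : F) k : iter n (@askew_betay F A D) (Pmon e%:A k) =
  Pmon (rho ^+ (k * n) * e)%:A k.
Proof.
elim: n => [|n IH]; first by rewrite muln0 mul1r.
by rewrite iterS IH askew_betay_mon askew_beta_scalar scalerA mulrA -exprD mulnS.
Qed.

(** Moving x past y multiplies the leading term by a power of rho and otherwise adds only lower
    powers of x; so e is a power of rho. *)
Lemma ambiskew_xy_exp_top n : (size ((x * y) ^+ n : {poly P})%R <= n.+1)%N /\
  exists2 e : F, e != 0 & ((x * y) ^+ n : {poly P})`_n = Pmon e%:A n.
Proof.
have w1 : (size ((x * y)%R : {poly P}) <= 2)%N /\
    ((x * y)%R : {poly P})`_1 = Pmon rho%:A 1.
  have sx : (size (x : {poly P}) <= 2)%N by rewrite size_polyX.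
  have sy : (size (y : {poly P}) <= 1)%N by rewrite size_polyC leq_b1.
  split; first exact: (ore_sizeM (m := 1) (n := 0) sx sy).
  rewrite (ore_coefM_top (m := 1) (n := 0) sx sy) coefX coefC mul1r /=.
  by rewrite ore_XE askew_betay_mon expr1 rmorph1.
elim: n => [|n [IHs [e e_neq0 IHc]]].
  split; first by rewrite size_poly1.
  by exists 1; rewrite ?oner_neq0 // coef1 scale1r /ore_mon scale1r.
have [s1 c1] := w1; rewrite exprS; split; first exact: (ore_sizeM s1 IHs).
exists (rho * (rho ^+ n * e)).
  by rewrite !mulf_neq0 ?expf_neq0 ?askew_rho_neq0.
rewrite -add1n (ore_coefM_top s1 IHs) c1 IHc /= askew_betay_mon askew_beta_scalar.
rewrite mon_mul scalerA; congr (Pmon _ _).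
by rewrite /= linearZ /= rmorph1 -scalerAl mul1r scalerA.
Qed.

Lemma size_phi0 n (b : B) : (size (b : {poly A}) <= n)%N ->
  (size (phi0 b : {poly P}) <= n)%N.
Proof.
move=> le_b; rewrite /phi0 (ore_eval_widen _ _ le_b).
apply: (leq_trans (size_sum _ _ _)); apply/bigmax_leqP => i _.
rewrite ore_CMl (leq_trans (size_scale_leq _ _)) //.
exact: leq_trans (ambiskew_xy_exp_top i).1 _.
Qed.

Lemma coef_phi0_top n (b : B) : (size (b : {poly A}) <= n.+1)%N ->
  (b : {poly A})`_n = 1 ->
  exists2 e : F, e != 0 & (phi0 b : {poly P})`_n = Pmon e%:A n.
Proof.
move=> le_b bn; have [_ [e e_neq0 Ee]] := ambiskew_xy_exp_top n; exists e => //.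
rewrite /phi0 (ore_eval_widen _ _ le_b) coef_sum big_ord_recr /= bn rmorph1 mul1r Ee.
rewrite big1 ?add0r // => i _; rewrite coef_ore_CM [X in _ * X]nth_default ?mulr0 //.
exact: leq_trans (ambiskew_xy_exp_top i).1 _.
Qed.

(** The leading coefficient of phi0(b) in x is a nonzero scalar times y^n, and right multiplication
    by it is injective on A[y; alpha], so degrees add. *)
Lemma mul_phi0_coef n (b : B) (r : R) : (size (b : {poly A}) <= n.+1)%N ->
  (b : {poly A})`_n = 1 -> r <> 0 ->
  exists2 j, (n <= j)%N & (r * phi0 b : {poly P})`_j <> 0.
Proof.
move=> le_b bn r_neq0; have [e e_neq0 Ee] := coef_phi0_top le_b bn.
pose k := (size (r : {poly P})).-1.
have r_gt0 : (0 < size (r : {poly P}))%N by rewrite size_poly_gt0; apply/eqP.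
have sr : (size (r : {poly P}) <= k.+1)%N by rewrite /k prednK.
exists (k + n)%N; first exact: leq_addl.
rewrite (ore_coefM_top sr (size_phi0 le_b)) Ee iter_betay_mon.
set e' := _ * e; have e'_neq0 : e' != 0 by rewrite mulf_neq0 ?expf_neq0 ?askew_rho_neq0.
set q := (r : {poly P})`_k.
have q_neq0 : q <> 0.
  by apply/eqP; rewrite -[q]lead_coefE lead_coef_eq0; apply/eqP.
move=> qe; apply: q_neq0; apply/polyP => i; rewrite coef0.
have := congr1 (fun t : P => (t : {poly A})`_(i + n)) qe.
rewrite ore_monE mulrA ore_MXn coefMXn coef0 ltnNge leq_addl /= addnK.
rewrite coef_null_MC.
have -> : iter i alpha e'%:A = e'%:A.
  by elim: (i) => // l IH; rewrite iterS IH rmorph_alg.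
by rewrite -scalerAr mulr1 => /eqP; rewrite scaler_eq0 (negPf e'_neq0) => /eqP.
Qed.

(** The image c of f satisfies c R in R c, so R c is an ideal. It is nonzero, and its nonzero
    members have degree at least n > 0 in x, which excludes 1. *)
Lemma normal_not_simple n (f : B) : (0 < n)%N ->
  (size (f : {poly A}) <= n.+1)%N -> (f : {poly A})`_n = 1 ->
  (forall i, gamma (f : {poly A})`_i = (f : {poly A})`_i) ->
  (forall a, f * C a = C (iter n gamma a) * f) ->
  tau f = C (rho ^- n)%:A * f -> ~ is_simple R.
Proof.
move=> n_gt0 sf f1 gf fC ft simpleR; set c := phi0 f.
have yc : y * c = cst (rho ^- n)%:A * c * y.
  by rewrite y_phi0 ft rmorphM /= phi0C.
have cx : c * x = cst (rho ^- n)%:A * x * c.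
  by rewrite phi0_x // ft rmorphM /= phi0C mulrA -cst_algC_comm.
have cy : c * y = cst (rho ^+ n)%:A * y * c.
  by rewrite -[RHS]mulrA yc !mulrA -rmorphM rhoAV rmorph1 mul1r.
have cC a : c * cst a = cst (iter n gamma a) * c.
  by rewrite -!phi0C -!rmorphM fC.
(* Such s are closed under sums and products, so A, x and y suffice. *)
pose Q s := exists s', c * s = s' * c.
have QM s t : Q s -> Q t -> Q (s * t).
  move=> [s' Es] [t' Et]; exists (s' * t').
  by rewrite mulrA Es -mulrA Et mulrA.
have QD s t : Q s -> Q t -> Q (s + t).
  by move=> [s' Es] [t' Et]; exists (s' + t'); rewrite mulrDr Es Et mulrDl.
have Q0 : Q 0 by exists 0; rewrite mulr0 mul0r.
have QX s k : Q s -> Q (s ^+ k).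
  move=> Qs; elim: k => [|k IH]; first by exists 1; rewrite mulr1 mul1r.
  by rewrite exprS; apply: (QM).
have cs s : Q s.
  elim/ore_ind: s => [//|s t|q j]; first exact: QD.
  rewrite ore_monE; apply: (QM); last first.
    by apply: QX; exists (cst (rho ^- n)%:A * x); apply: cx.
  elim/ore_ind: q => [|q1 q2 Q1 Q2|a i].
  - by rewrite raddf0.
  - by rewrite raddfD; apply: (QD).
  rewrite ore_monE rmorphM rmorphXn; apply: (QM).
    by exists (cst (iter n gamma a)); apply: cC.
  by apply: QX; exists (cst (rho ^+ n)%:A * y); apply: cy.
have one_neq0 : (1 : R) <> 0 by apply/eqP/oner_neq0.
have [|I0|I1] := simpleR (fun r => exists r', r = r' * c).
- split=> [|_ _ [r ->] [s ->]|r _ [s ->]|_ s [r ->]].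
  + by exists 0; rewrite mul0r.
  + by exists (r - s); rewrite mulrBl.
  + by exists (r * s); rewrite mulrA.
  + by have [s' Es] := cs s; exists (r * s'); rewrite -!mulrA Es.
- have c0 : c = 0 by apply/I0; exists 1; rewrite mul1r.
  have [j _] := mul_phi0_coef sf f1 one_neq0.
  by rewrite -/c c0 mulr0 coef0.
have [r rc] := I1 1.
have r_neq0 : r <> 0 by move=> r0; apply: one_neq0; rewrite rc r0 mul0r.
have [j le_nj] := mul_phi0_coef sf f1 r_neq0.
by rewrite -/c -rc coef1; case: j le_nj => //; case: n n_gt0 {sf f1 fC ft yc cx cy cC}.
Qed.

Lemma ppoly_datum_not_simple p : p \in [pchar F] -> ppoly_datum p D -> ~ is_simple R.
Proof.
move=> hp [n [b [u [hb [ug [un _] uv]]]]].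
have prp := pcharf_prime hp; have p_gt1 := prime_gt1 prp.
have hpB : p \in [pchar B].
  by apply: (rmorph_pchar C); apply: (rmorph_pchar (in_alg A)).
set d := (p ^ n)%N in hb un uv *.
have d_gt0 : (0 < d)%N by rewrite expn_gt0 prime_gt0.
have lt_id (i : 'I_n) : (p ^ i < d)%N by rewrite ltn_exp2l.
(* In characteristic p, tau(w)^(p^i) has no mixed terms, so tau adds to this p-polynomial only terms
   in v. *)
pose f : B := w ^+ d + \sum_(i < n) C (b i) * w ^+ (p ^ i) + C u.
have coef_f k : (f : {poly A})`_k = (k == d)%:R +
    \sum_(i < n) b i * (k == (p ^ i)%N)%:R + (if k == 0%N then u else 0).
  rewrite /f !coefD coefC -[w ^+ d]mul1r ore_MXn mul1r coefXn coef_sum.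
  congr (_ + _ + _); apply: eq_bigr => i _.
  by rewrite coef_ore_CM -[w ^+ _]mul1r ore_MXn mul1r coefXn.
have tau_pX i : tau (w ^+ (p ^ i)) =
    C (rho ^- (p ^ i))%:A * (w ^+ (p ^ i) - C (v ^+ (p ^ i))).
  rewrite rmorphXn /= tauw /askew_tauw exprMn_comm; last first.
    apply: commrB; rewrite /GRing.comm; first by rewrite null_XC /= rmorph_alg.
    by rewrite -!ore_CM algC_comm.
  rewrite exprB_pX_comm //; last exact/commr_sym/w_comm_v.
  by rewrite -!rmorphXn /= exprZn expr1n exprVn.
apply: (@normal_not_simple d f) => //.
- apply/leq_sizeP => k lt_dk; rewrite coef_f gtn_eqF // big1 => [|i _].
    by rewrite gtn_eqF ?addr0 // (leq_trans _ lt_dk).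
  by rewrite gtn_eqF ?mulr0 // (leq_trans (lt_id i)) // ltnW.
- rewrite coef_f eqxx big1 => [|i _]; first by rewrite gtn_eqF // !addr0.
  by rewrite gtn_eqF ?mulr0.
- move=> k; rewrite coef_f !rmorphD rmorph_nat rmorph_sum /=; congr (_ + _ + _).
    by apply: eq_bigr => i _; rewrite rmorphM rmorph_nat /=; have [-> _ _] := hb i.
  by case: ifP => // _; rewrite raddf0.
- move=> a; rewrite /f !mulrDl !mulrDr null_XnC -!rmorphM un; congr (_ + _ + _).
  rewrite mulr_suml mulr_sumr; apply: eq_bigr => i _.
  have [_ [bn _] _] := hb i.
  by rewrite -mulrA null_XnC !mulrA -!rmorphM bn -iterD subnK // ltnW.
rewrite {1}/f !rmorphD rmorph_sum /= tau_pX tauC.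
(* Condition (b) solved for alpha(u); its terms in v cancel those coming from the powers of
   tau(w). *)
have -> : alpha u = (rho ^- d)%:A * (u + v ^+ d + \sum_(i < n) b i * v ^+ (p ^ i)).
  rewrite -addrA -uv addrC subrK mulr_algl scalerA mulVf ?scale1r //.
  by rewrite expf_neq0 ?askew_rho_neq0.
have -> : \sum_(i < n) tau (C (b i) * w ^+ (p ^ i)) =
    C (rho ^- d)%:A * \sum_(i < n) (C (b i) * w ^+ (p ^ i) - C (b i * v ^+ (p ^ i))).
  rewrite mulr_sumr; apply: eq_bigr => i _.
  have [_ _ ab] := hb i; rewrite rmorphM /= tau_pX tauC.
  have -> : alpha (b i) = (rho ^- d)%:A * b i * (rho ^+ (p ^ i))%:A.
    rewrite ab expfzDr ?askew_rho_neq0 // -exprnN -exprnP mulr_algl.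
    by rewrite -algC_comm mulr_algl scalerA.
  rewrite !rmorphM -!mulrA; congr (_ * _); rewrite -mulrBr; congr (_ * _).
  by rewrite mulrA -rmorphM rhoAV rmorph1 mul1r.
rewrite rmorphM -!mulrDr; congr (_ * _).
rewrite sumrB !rmorphD rmorph_sum /= /f.
set X1 := w ^+ d; set X2 := \sum_(i < n) C (b i) * _; set X3 := \sum_(i < n) _.
by rewrite addrACA subrK [C u + _]addrC addrA subrK addrAC.
Qed.

End NormalElement.

Theorem theorem3p15 (F : fieldType) (p : nat) (hp : p \in [pchar F])
    (A : algType F) (D : ambiskewData A) :
  is_simple (ambiskew D) <->
  [/\ is_map_simple (askew_alpha D),
      ~ (exists (n : nat) (b : 'I_n -> A) (u : A),
          (forall i : 'I_n,
             [/\ askew_gamma D (b i) = b i,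
                 is_normal (iter (p ^ n - p ^ i)%N (askew_gamma D)) (b i) &
                 askew_alpha D (b i) =
                   askew_rho D ^ ((p ^ i)%:Z - (p ^ n)%:Z) *: b i]) /\
          [/\ askew_gamma D u = u,
              is_normal (iter (p ^ n)%N (askew_gamma D)) u &
              askew_rho D ^+ (p ^ n)%N *: askew_alpha D u - u =
                askew_v D ^+ (p ^ n)%N +
                \sum_(i < n) b i * askew_v D ^+ (p ^ i)%N]) &
      forall m : nat, (1 <= m)%N -> is_unit (askew_vm D m)].
Proof.
split=> [simpleR|[alpha_simple no_datum vm_unit]].
  split; first exact: simple_alpha_simple.
    by move=> datum; apply: (ppoly_datum_not_simple hp datum).
  by case=> // m _; apply: simple_vm_unit.
apply: ambiskew_simple => // s f.
exact: (shift_normal_size hp alpha_simple no_datum).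
Qed.
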